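(* Let $d\ge2$, $p,r\in\mathbb N$, $q\in\mathbb Z_+$. Then $$\frac{\bar h_{d-1}(2r)}{2r}\ge h_d\ge\frac{\bar h_{d-1}(p+2q)-\bar h_{d-1}(2q)}{p},\qquad \frac{\check h_{d-1}(2r)}{2r}\ge\tilde h_d\ge\frac{\check h_{d-1}(p+2q)-\check h_{d-1}(2q)}{p}.$$ Moreover, if $\mathbf m'=(m_1,\dots,m_{d-1})\in\mathbb N^{d-1}$ with $m_1,\dots,m_{d-1}$ all even, then $$h_d\le\frac{\log\beta(\mathbf m')}{|\mathbf m'|_{\mathrm{pr}}},\qquad \tilde h_d\le\frac{\log\tilde\beta(\mathbf m')}{|\mathbf m'|_{\mathrm{pr}}}.$$
   Context: Notation: $\langle\mathbf m\rangle=\{1,\dots,m_1\}\times\cdots\times\{1,\dots,m_d\}$, $|\mathbf m|_{\mathrm{pr}}=\prod m_i$, $\mathbf e_k$ unit vectors, $\mathbf m\to\infty$ means all coordinates tend to $\infty$. Colors $\{1,\dots,2d+1\}$, $\Gamma=(\Gamma_1,\dots,\Gamma_d)$: $(k,q)\in\Gamma_k\iff q=k+d$, and for $j\ne k$, $(j,q)\in\Gamma_k\iff q\ne k+d$. $W(\mathbf m)$: maps $\phi:\langle\mathbf m\rangle\to\{1,\dots,2d+1\}$ with $(\phi_{\mathbf i},\phi_{\mathbf i+\mathbf e_k})\in\Gamma_k$ whenever both points are in $\langle\mathbf m\rangle$ (monomer-dimer covers, dimers may protrude). For $K\subseteq\{1,\dots,d\}$, $W_{\mathrm{per},K}(\mathbf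 m)$ is the set of $\phi\in W(\mathbf m)$ satisfying in addition $(\phi_{\mathbf i},\phi_{\mathbf i'})\in\Gamma_k$ for all $k\in K$ and all $\mathbf i$ with $i_k=m_k$, where $\mathbf i'$ is $\mathbf i$ with $k$-th coordinate replaced by $1$ (periodic in the directions of $K$). Tilde versions $\widetilde W,\widetilde W_{\mathrm{per},K}$ use colors $\{1,\dots,2d\}$ only (dimer covers). $h_d=\lim_{\mathbf m\to\infty}\log\#W(\mathbf m)/|\mathbf m|_{\mathrm{pr}}$, $\tilde h_d=\lim_{\mathbf m\to\infty}\log\#\widetilde W(\mathbf m)/|\mathbf m|_{\mathrm{pr}}$. For $m_1\in\mathbb N$, $\bar h_{d-1}(m_1)=\lim_{\mathbf m^-\to\infty}\frac{\log\#W_{\mathrm{per},\{1\}}(m_1,\mathbf m^-)}{|\mathbf m^-|_{\mathrm{pr}}}$ and $\check h_{d-1}(m_1)=\lim_{\mathbf m^-\to\infty}\frac{\log\#\widetilde W_{\mathrm{per},\{1\}}(m_1,\mathbf m^-)}{|\mathbf m^-|_{\mathrm{pr}}}$, with $\mathbf m^-\in\mathbb N^{d-1}$ (these limits exist); also $\bar h_{d-1}(0)=\check h_{d-1}(0)=\log 2$. For $\mathbf m'\in\mathbb N^{d-1}$: the torus multigraph of $T(\mathbf m')=\prod_k\mathbb Z/m_k\mathbb Z$ (identified with $\langle\mathbf m'\rangle$) has, for each vertex $\mathbf i$ and each $k$ with $m_k\ge2$, one edge joining $\mathbf i$ and $\mathbf i+\mathbf e_k$ (mod $m_k$), so two distinct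 parallel edges when $m_k=2$. $B(\mathbf m')$ is indexed by pairs $(S,T)$ of subsets of $\langle\mathbf m'\rangle$, with entry $0$ if $S\cap T\ne\emptyset$ and otherwise the number of sets of pairwise vertex-disjoint edges of the torus multigraph with all endpoints in $U=\langle\mathbf m'\rangle\setminus(S\cup T)$; $\tilde B(\mathbf m')$ likewise but counting only edge sets covering every point of $U$ (value $1$ if $U=\emptyset$). $\beta(\mathbf m'),\tilde\beta(\mathbf m')$ are their spectral radii. *)

(* Defs.v *)
From mathcomp Require Import all_boot all_order all_algebra.
From mathcomp Require Import complex.
From mathcomp Require Import all_classical all_reals.
From mathcomp Require Import filter topology normedtype sequences exp.

Set Implicit Arguments.
Unset Strict Implicit.
Unset Printing Implicit Defensive.

Import Order.TTheory GRing.Theory Num.Theory.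
Import numFieldNormedType.Exports.

Local Open Scope ring_scope.

(* Indices are 0-based throughout: directions are 0, ..., d-1, the k-th       *)
(* coordinate of a point ranges over 0, ..., m_k - 1, and the colors are      *)
(* 0, ..., 2d.  Colors k and k + d (k < d) are the two halves of a dimer in   *)
(* direction k; color 2d is a monomer.                                        *)

Definition box (d : nat) (m : d.-tuple nat) : finType :=
  {dffun forall k : 'I_d, 'I_(tnth m k)}.

Definition mpr (d : nat) (m : d.-tuple nat) : nat :=
  (\prod_(k < d) tnth m k)%N.

Definition color (d : nat) : finType := 'I_(2 * d).+1.

Definition Gamma (d : nat) (k : 'I_d) : rel (color d) := fun j q =>
  if (j == k :> nat)%N then (q == k + d :> nat)%N else (q != k + d :> nat)%N.

(* i' = i + e_k, without wrap-around *)
Definition box_next (d : nat) (m : d.-tuple nat) (k : 'I_d) : rel (box m) :=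
  fun i i' => [forall l, (i' l == i l + (l == k) :> nat)%N].

(* i is on the last face in direction k and i' is the opposite point on the   *)
(* first face; i' = i when m_k = 1                                            *)
Definition box_wrap (d : nat) (m : d.-tuple nat) (k : 'I_d) : rel (box m) :=
  fun i i' => [&& ((i k).+1 == tnth m k)%N, (i' k == 0 :> nat)%N
    & [forall l, (l != k) ==> (i' l == i l)]].

Definition W (d : nat) (m : d.-tuple nat) : {set {ffun box m -> color d}} :=
  [set phi : {ffun box m -> color d} | [forall k : 'I_d, forall i : box m,
     forall i' : box m, box_next k i i' ==> Gamma k (phi i) (phi i')]].

Definition Wper (d : nat) (K : {set 'I_d}) (m : d.-tuple nat) :
    {set {ffun box m -> color d}} :=
  [set phi in W m | [forall k in K, forall i : box m, forall i' : box m,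
     box_wrap k i i' ==> Gamma k (phi i) (phi i')]].

Definition no_monomer (d : nat) (m : d.-tuple nat)
    (phi : {ffun box m -> color d}) : bool :=
  [forall i, (phi i < 2 * d)%N].

Definition Wt (d : nat) (m : d.-tuple nat) : {set {ffun box m -> color d}} :=
  [set phi in W m | no_monomer phi].

Definition Wtper (d : nat) (K : {set 'I_d}) (m : d.-tuple nat) :
    {set {ffun box m -> color d}} :=
  [set phi in Wper K m | no_monomer phi].

(* The filter "m -> oo", i.e. all coordinates of m tend to infinity.          *)
Definition minfty (d : nat) : set_system (d.-tuple nat) :=
  fun P => exists N : nat,
    forall m : d.-tuple nat, (forall k, (N <= tnth m k)%N) -> P m.
Arguments minfty : clear implicits.

Global Instance minfty_filter (d : nat) : ProperFilter (minfty d).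
Proof.
apply: Build_ProperFilter_ex.
  move=> P [N PN]; exists (nseq_tuple d N); apply: PN => k.
  by rewrite (tnth_nth N) nth_nseq ltn_ord.
split; first by exists 0%N.
- move=> P Q [N PN] [M QM]; exists (maxn N M) => m mNM; split.
    by apply: PN => k; apply: leq_trans (mNM k); exact: leq_maxl.
  by apply: QM => k; apply: leq_trans (mNM k); exact: leq_maxr.
- by move=> P Q PQ [N PN]; exists N => m /PN /PQ.
Qed.

Definition h (R : realType) (d : nat) : R :=
  lim (ln (#|W m|%:R : R) / (mpr m)%:R @[m --> minfty d])%classic.

Definition ht (R : realType) (d : nat) : R :=
  lim (ln (#|Wt m|%:R : R) / (mpr m)%:R @[m --> minfty d])%classic.

(* In hbar and hcheck, e is the dimension of m^-; the covers live in          *)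
(* dimension e + 1.                                                           *)
Definition hbar (R : realType) (e : nat) (m1 : nat) : R :=
  if m1 == 0%N then ln 2 else
  lim (ln (#|Wper [set ord0] (cons_tuple m1 m)|%:R : R) / (mpr m)%:R
       @[m --> minfty e])%classic.

Definition hcheck (R : realType) (e : nat) (m1 : nat) : R :=
  if m1 == 0%N then ln 2 else
  lim (ln (#|Wtper [set ord0] (cons_tuple m1 m)|%:R : R) / (mpr m)%:R
       @[m --> minfty e])%classic.

Definition torus_next (e : nat) (m : e.-tuple nat) (k : 'I_e) (i : box m) :
    box m :=
  [ffun l => if l == k then ordS (i l) else i l].

(* The pair (i, k) stands for the edge joining i and i + e_k, so that for     *)
(* m_k = 2 the pairs (i, k) and (i + e_k, k) are distinct parallel edges.     *)
Definition edges (e : nat) (m : e.-tuple nat) : {set box m * 'I_e} :=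
  [set a | (2 <= tnth m a.2)%N].

Definition ends (e : nat) (m : e.-tuple nat) (a : box m * 'I_e) :
    {set box m} :=
  [set a.1; torus_next a.2 a.1].

Definition matchings (e : nat) (m : e.-tuple nat) (U : {set box m}) :
    {set {set box m * 'I_e}} :=
  [set M : {set box m * 'I_e} |
    [&& M \subset edges m,
        [forall a in M, forall b in M,
           (a != b) ==> [disjoint ends a & ends b]]
      & [forall a in M, ends a \subset U]]].

Definition perfect_matchings (e : nat) (m : e.-tuple nat) (U : {set box m}) :
    {set {set box m * 'I_e}} :=
  [set M in matchings U | U \subset \bigcup_(a in M) ends a].

Definition B (R : realType) (e : nat) (m : e.-tuple nat) :
    'M[R]_#|{: {set box m}}| :=
  \matrix_(s, t) let S := enum_val s in let T := enum_val t in
    if S :&: T != finset.set0 then 0 else #|matchings (~: (S :|: T))|%:R.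

Definition Bt (R : realType) (e : nat) (m : e.-tuple nat) :
    'M[R]_#|{: {set box m}}| :=
  \matrix_(s, t) let S := enum_val s in let T := enum_val t in
    if S :&: T != finset.set0 then 0
    else #|perfect_matchings (~: (S :|: T))|%:R.

Definition spectral_radius (R : realType) (n : nat) (A : 'M[R]_n) : R :=
  sup [set Normc.normc z
      | z in [set z : R[i] | eigenvalue (map_mx (real_complex R) A) z]]%classic.

(* Main.v *)
Require Import Defs.
From mathcomp Require Import all_boot all_order all_algebra.
From mathcomp Require Import perm sesquilinear spectral complex.
From mathcomp Require Import all_classical all_reals.
From mathcomp Require Import filter topology normedtype sequences exp.
From mathcomp Require Import ring lra zify.

Set Implicit Arguments.
Unset Strict Implicit.
Unset Printing Implicit Defensive.

Import Order.TTheory GRing.Theory Num.Theory.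
Import numFieldNormedType.Exports.

(* Let A be the transfer matrix in one non-periodic direction: its rows and
   columns are indexed by the sets of sites of a layer that are joined by dimers
   to the neighbouring layers, so that covers of n layers are counted by the sum
   of the entries of A^n, and covers periodic in that direction by tr A^n.
   Exchanging the two halves of the dimers in that direction shows that A is
   symmetric, hence A^(2r) has nonnegative eigenvalues, and with N the size of A
   and s_n the sum of the entries of A^n,
     s_(2rn) <= N (tr A^(2r))^n,
     (tr A^(p+2q))^(2n) <= s_(2np) (tr A^(2q))^(2n).
   Taking logarithms and letting all sizes tend to infinity at once gives the
   two-sided bounds (the limits exist by Fekete's lemma, as s_(x+y) <= s_x s_y).
   The first inequality holds in any direction whatever the directions that are
   already periodic; applying it to the first d-1 directions in turn leaves a
   torus whose transfer matrix in the last direction is bounded entrywise by the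
   matrix B, and s_n <= N beta^n for that one. *)

Local Open Scope ring_scope.

(** * Symmetric matrices *)

Lemma expmx_conj (C : fieldType) n (P : 'M[C]_n) (D : 'rV[C]_n) k :
  P \in unitmx ->
  (invmx P *m diag_mx D *m P) ^+ k
    = invmx P *m diag_mx (\row_i D 0 i ^+ k) *m P.
Proof.
move=> uP; elim: k => [|k IHk].
  rewrite expr0; have -> : diag_mx (\row_i D 0 i ^+ 0) = 1%:M :> 'M[C]_n.
    by apply/matrixP => i j; rewrite !mxE expr0.
  by rewrite mulmx1 mulVmx.
rewrite exprS IHk -mulmxE !mulmxA mulmxK //; congr (_ *m _).
rewrite -!mulmxA mulmx_diag; congr (_ *m diag_mx _).
by apply/rowP => i; rewrite !mxE exprS.
Qed.

Definition entry_sum (R : nmodType) n (A : 'M[R]_n) : R :=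
  \sum_i \sum_j A i j.

(** By the spectral theorem a unitary [P] diagonalises [A]. The entry sum is the quadratic form of
    [A ^+ k] at the all-ones vector, and [y] is that vector in the eigenbasis. *)
Lemma hermitian_spectrum (C : numClosedFieldType) n (A : 'M[C]_n) :
  A \is hermsymmx ->
  exists D y : 'I_n -> C,
  [/\ forall i, D i \is Num.real,
      forall k, \tr (A ^+ k) = \sum_i D i ^+ k,
      forall k, entry_sum (A ^+ k) = \sum_i `|y i| ^+ 2 * D i ^+ k
    & forall i, eigenvalue A (D i)].
Proof.
move=> hermA; pose P := spectralmx A; pose D := spectral_diag A.
have uP : P \in unitmx := spectral_unit A.
have defA : A = invmx P *m diag_mx D *m P.
  exact/orthomx_spectralP/hermitian_normalmx.
have Ak k : A ^+ k = invmx P *m diag_mx (\row_i D 0 i ^+ k) *m P.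
  by rewrite -expmx_conj // -defA.
exists (D 0), (fun i => \sum_j P i j); split.
- by move=> i; have /mxOverP/(_ 0 i) := hermitian_spectral_diag_real hermA.
- move=> k; rewrite Ak -mulmxA mxtrace_mulC -mulmxA mulmxV // mulmx1.
  by rewrite mxtrace_diag; apply: eq_bigr => i _; rewrite mxE.
- move=> k; rewrite /entry_sum.
  transitivity (\sum_i \sum_j \sum_l (P l i)^* * D 0 l ^+ k * P l j).
    apply: eq_bigr => i _; apply: eq_bigr => j _ /=.
    rewrite Ak invmx_unitary ?spectral_unitarymx // mul_mx_diag mxE.
    by apply: eq_bigr => l _; rewrite !mxE.
  transitivity (\sum_l \sum_i \sum_j (P l i)^* * D 0 l ^+ k * P l j).
    by rewrite [RHS]exchange_big; apply: eq_bigr => i _; rewrite exchange_big.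
  apply: eq_bigr => l _; rewrite normCK rmorph_sum -[RHS]mulrA [RHS]mulrC.
  by rewrite !mulr_suml; apply: eq_bigr => i _; rewrite mulr_sumr.
- move=> i; apply/eigenvalueP; exists (row i P).
    rewrite {1}defA -row_mul !mulmxA mulmxV // mul1mx.
    by rewrite mul_diag_mx; apply/rowP => j; rewrite !mxE.
  apply: contraTneq uP => Pi0; rewrite unitmxE (expand_det_row _ i).
  rewrite big1 ?unitr0 // => j _.
  by have /rowP/(_ j) := Pi0; rewrite !mxE => ->; rewrite mul0r.
Qed.

(** Real form of the preceding: the weights [w i] are the squared moduli of the coordinates of the
    all-ones vector in an orthonormal eigenbasis, whence their nonnegativity and their total [n]. *)
Lemma symmetric_spectrum (R : realType) n (A : 'M[R]_n) : A^T = A ->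
  exists D w : 'I_n -> R,
  [/\ forall i, 0 <= w i,
      \sum_i w i = n%:R,
      forall k, \tr (A ^+ k) = \sum_i D i ^+ k,
      forall k, entry_sum (A ^+ k) = \sum_i w i * D i ^+ k
    & forall i, eigenvalue (map_mx (real_complex R) A) (D i)%:C%C].
Proof.
move=> symA; pose AC := map_mx (real_complex R) A.
have hermA : AC \is hermsymmx.
  apply: realsym_hermsym.
    by apply/is_hermitianmxP; rewrite expr0 scale1r map_mx_id // map_trmx symA.
  by apply/mxOverP => i j; rewrite mxE complex_real.
have [D [y [realD trE sE eigD]]] := hermitian_spectrum hermA.
have Ak k : AC ^+ k = map_mx (real_complex R) (A ^+ k).
  elim: k => [|k IHk]; first by rewrite !expr0 map_mx1.
  by rewrite !exprS -!mulmxE map_mxM IHk.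
pose d i := complex.Re (D i).
have DE i : D i = (d i)%:C%C by have /RRe_real -> := realD i.
pose w i := complex.Re (y i) ^+ 2 + complex.Im (y i) ^+ 2.
have wsE k : entry_sum (A ^+ k) = \sum_i w i * d i ^+ k.
  apply: complexI; transitivity (entry_sum (AC ^+ k)).
    rewrite /entry_sum rmorph_sum; apply: eq_bigr => i _.
    by rewrite rmorph_sum; apply: eq_bigr => j _; rewrite Ak mxE.
  rewrite sE rmorph_sum; apply: eq_bigr => i _.
  by rewrite rmorphM rmorphXn /= -DE add_Re2_Im2.
exists d, w; split.
- by move=> i; rewrite addr_ge0 ?sqr_ge0.
(* The total weight is the case [k = 0]: the entries of the identity sum to [n]. *)
- have := wsE 0%N; rewrite expr0 /entry_sum => e0.
  transitivity (\sum_i w i * d i ^+ 0).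
    by apply: eq_bigr => i _; rewrite mulr1.
  rewrite -e0 -[n in RHS]card_ord -sumr_const; apply: eq_bigr => i _.
  rewrite (bigD1 i) //= mxE eqxx big1 ?addr0 // => j ji.
  by rewrite mxE eq_sym (negbTE ji).
- move=> k; apply: complexI.
  rewrite -trace_map_mx -Ak trE rmorph_sum; apply: eq_bigr => i _.
  by rewrite rmorphXn /= -DE.
- exact: wsE.
- by move=> i; rewrite -DE.
Qed.

Section SymmetricInequalities.
Variables (R : realType) (n : nat) (A : 'M[R]_n).
Hypotheses (symA : A^T = A) (A_ge0 : forall i j, 0 <= A i j).

Lemma expmx_ge0 k i j : 0 <= (A ^+ k) i j.
Proof.
elim: k i j => [|k IHk] i j; first by rewrite expr0 mxE ler0n.
by rewrite exprS -mulmxE mxE sumr_ge0 // => l _; rewrite mulr_ge0.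
Qed.

Lemma mxtrace_le_entry_sum k : \tr (A ^+ k) <= entry_sum (A ^+ k).
Proof.
rewrite /entry_sum; apply: ler_sum => i _; rewrite [leRHS](bigD1 i) //= lerDl.
by apply: sumr_ge0 => j _; exact: expmx_ge0.
Qed.

(** Expanding the product on the right gives all terms [B i u * C v j], which are nonnegative; those
    with [u = v] make up the left side. This submultiplicativity feeds Fekete's lemma. *)
Lemma entry_sum_expD k l :
  entry_sum (A ^+ (k + l)) <= entry_sum (A ^+ k) * entry_sum (A ^+ l).
Proof.
rewrite exprD -mulmxE; set B := A ^+ k; set C := A ^+ l.
have B0 i j : 0 <= B i j by exact: expmx_ge0.
have C0 i j : 0 <= C i j by exact: expmx_ge0.
rewrite {2}/entry_sum mulr_suml; apply: ler_sum => i _.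
rewrite mulr_suml.
under eq_bigr do rewrite mxE.
rewrite exchange_big /=; apply: ler_sum => u _.
rewrite -mulr_sumr ler_wpM2l // /entry_sum [leRHS](bigD1 u) //= lerDl.
by do 2!apply: sumr_ge0 => ? _.
Qed.

(** Even powers of the real eigenvalues are nonnegative, so each [D i ^+ (2 * r)] is at most the
    trace; the weights then contribute their total [n]. *)
Lemma entry_sum_exp_le_trace r k :
  entry_sum (A ^+ (2 * r * k)) <= n%:R * \tr (A ^+ (2 * r)) ^+ k.
Proof.
have [D [w [w0 sumw trE sE _]]] := symmetric_spectrum symA.
rewrite sE trE -sumw mulr_suml; apply: ler_sum => i _.
have D0 j : 0 <= D j ^+ (2 * r) by rewrite exprM exprn_ge0 ?sqr_ge0.
rewrite ler_wpM2l // exprM lerXn2r ?nnegrE ?sumr_ge0 //.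
by rewrite (bigD1 i) //= lerDl sumr_ge0.
Qed.

(* With [rho] the spectral radius, [\tr A^(p+2q) <= rho^p * \tr A^(2q)] and
   [rho^(2kp) <= \tr A^(2kp)]. *)
Lemma mxtrace_exp_le_entry_sum p q k : (0 < n)%N ->
  \tr (A ^+ (p + 2 * q)) ^+ (2 * k)
    <= entry_sum (A ^+ (2 * k * p)) * \tr (A ^+ (2 * q)) ^+ (2 * k).
Proof.
move=> n_gt0; have [D [w [w0 sumw trE sE _]]] := symmetric_spectrum symA.
apply: le_trans (ler_wpM2r _ (mxtrace_le_entry_sum _)); last first.
  by rewrite exprM exprn_ge0 ?sqr_ge0.
have even_ge0 i l : 0 <= D i ^+ (2 * l) by rewrite exprM exprn_ge0 ?sqr_ge0.
have [i0 _ Dmax] := @arg_maxP _ _ _ (Ordinal n_gt0) xpredT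
  (fun i => `|D i|) isT.
rewrite !trE.
apply: (@le_trans _ _
    (`|D i0| ^+ (2 * k * p) * (\sum_i D i ^+ (2 * q)) ^+ (2 * k))).
  (* The exponent [2 * k] is even, so the trace may be replaced by its absolute value; it remains to
     compare the bases, that is [|tr A^(p+2q)|] with [|D i0|^p * tr A^(2q)]. *)
  rewrite -[leLHS]ger0_norm; last by rewrite exprM exprn_ge0 ?sqr_ge0.
  rewrite normrX (mulnC (2 * k)%N p) [X in _ <= X * _]exprM -exprMn.
  rewrite lerXn2r ?nnegrE //.
    by rewrite mulr_ge0 ?exprn_ge0 ?sumr_ge0.
  apply: le_trans (ler_norm_sum _ _ _) _; rewrite mulr_sumr.
  apply: ler_sum => i _; rewrite exprD normrM normrX (ger0_norm (even_ge0 _ _)).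
  by rewrite ler_wpM2r // lerXn2r ?nnegrE //; exact: Dmax.
rewrite ler_wpM2r //; first by rewrite exprM exprn_ge0 ?sqr_ge0.
rewrite -mulnA -normrX ger0_norm // [leRHS](bigD1 i0) //= lerDl.
by rewrite sumr_ge0.
Qed.

Lemma entry_sum_exp_le_spectral_radius k :
  entry_sum (A ^+ k) <= n%:R * spectral_radius A ^+ k.
Proof.
have [D [w [w0 sumw trE sE eigD]]] := symmetric_spectrum symA.
rewrite sE -sumw mulr_suml; apply: ler_sum => i _.
rewrite ler_wpM2l //.
suff Dle : `|D i| <= spectral_radius A.
  apply: le_trans (ler_norm _) _; rewrite normrX lerXn2r ?nnegrE //.
  exact: le_trans Dle.
apply: ub_le_sup; last first.
  exists (D i)%:C%C => /=; first exact: eigD.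
  by rewrite expr0n /= addr0 sqrtr_sqr.
(* A [sup] dominates the members of its set only if the set is bounded: the eigenvalues are roots of
   the characteristic polynomial, and the sum of the moduli of all its roots is a bound. *)
have [s sE'] :=
  closed_field_poly_normal (char_poly (map_mx (real_complex R) A)).
exists (\sum_(z <- s) Normc.normc z) => _ [z /= + <-].
rewrite eigenvalue_root_char sE'.
have /monicP -> := char_poly_monic (map_mx (real_complex R) A).
rewrite scale1r root_prod_XsubC => zs.
rewrite (big_rem z) //= lerDl sumr_ge0 // => x _.
by case: x => a b /=; rewrite sqrtr_ge0.
Qed.
End SymmetricInequalities.

(** * Walks and transfer matrices *)

Section Chains.
Variables (R : realType) (T S : finType) (P : pred T) (src dst : T -> S).

(** The adjacency matrix of a directed multigraph on [S], in which each letter [c] satisfying [P] is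
    an edge from [src c] to [dst c]. *)
Definition transfer_mx : 'M[R]_#|S| :=
  \matrix_(s, t) #|[set c | [&& P c, src c == enum_val s
                              & dst c == enum_val t]]|%:R.

Fixpoint chain (s t : S) (w : seq T) : bool :=
  if w is c :: w' then [&& P c, src c == s & chain (dst c) t w'] else s == t.

Lemma natr_card (I : finType) (Q : pred I) :
  #|[set i | Q i]|%:R = \sum_i (Q i)%:R :> R.
Proof.
rewrite -sum1dep_card natr_sum big_mkcond.
by apply: eq_bigr => i _; case: (Q i).
Qed.

Lemma big_tuple_cons n (F : n.+1.-tuple T -> R) :
  \sum_w F w = \sum_c \sum_(w : n.-tuple T) F [tuple of c :: w].
Proof.
rewrite pair_big /=.
rewrite (reindex (fun p : T * n.-tuple T => [tuple of p.1 :: p.2])) //.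
exists (fun w : n.+1.-tuple T => (thead w, [tuple of behead w])).
  by case=> c w _; congr (_, _); apply: val_inj.
by move=> w _; case/tupleP: w => c w; apply: val_inj.
Qed.

(** Powers of an adjacency matrix count walks: in the induction on the first letter [c], the
    intermediate state must be [dst c], so the sum over states collapses. *)
Lemma transfer_mx_exp n s t :
  (transfer_mx ^+ n) s t
    = #|[set w : n.-tuple T | chain (enum_val s) (enum_val t) w]|%:R.
Proof.
elim: n s => [|n IHn] s.
  rewrite expr0 mxE natr_card (bigD1 [tuple]) //= big1 ?addr0 => [|w].
    by rewrite (inj_eq enum_val_inj).
  by case/eqP; exact: tuple0.
rewrite exprS -mulmxE mxE natr_card big_tuple_cons.
transitivity (\sum_(u < #|S|) \sum_c \sum_(w : n.-tuple T)
  ([&& P c, src c == enum_val s & dst c == enum_val (A := S) u]%:R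
   * (chain (enum_val u) (enum_val t) w)%:R : R)).
  apply: eq_bigr => u _; rewrite mxE IHn !natr_card mulr_suml.
  by apply: eq_bigr => c _; rewrite mulr_sumr.
rewrite exchange_big; apply: eq_bigr => c _ /=.
rewrite exchange_big; apply: eq_bigr => w _ /=.
rewrite (bigD1 (enum_rank (dst c))) //= enum_rankK eqxx andbT.
rewrite big1 ?addr0 => [|u /eqP neq].
  by rewrite -natrM mulnb; congr (_%:R); case: (P c); case: (_ == _).
rewrite [dst c == _](introF eqP) ?andbF ?mul0r // => e.
by apply: neq; rewrite e enum_valK.
Qed.

(** Separates the two end states from the inner compatibility of the letters, so that sums over end
    states can be evaluated. *)
Lemma chain_cons s t c w :
  chain s t (c :: w) = [&& src c == s, dst (last c w) == t, all P (c :: w)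
    & path (fun c c' => dst c == src c') c w].
Proof.
elim: w s c => [|c' w IHw] s c /=.
  by rewrite !andbT; case: (P c); rewrite /= ?andbT ?andbF.
have /= -> := IHw (dst c) c'; rewrite [src c' == _]eq_sym.
by case: (P c); case: (src c == s); case: (dst c == src c');
  case: (dst (last c' w) == t); rewrite //= ?andbT ?andbF.
Qed.

Lemma sum_enum_val (F : S -> R) : \sum_(s < #|S|) F (enum_val s) = \sum_s F s.
Proof.
by rewrite (reindex (@enum_val S S)) //; apply: onW_bij; exact: enum_val_bij.
Qed.

(** A nonempty walk determines its end states, so it is counted once in the sum over all pairs of
    states. The empty walk would be counted once per state, hence the exponent [n.+1]. *)
Lemma entry_sum_transfer_mx n :
  entry_sum (transfer_mx ^+ n.+1)
    = #|[set w : n.+1.-tuple T | all P w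
          && sorted (fun c c' => dst c == src c') w]|%:R.
Proof.
rewrite natr_card /entry_sum.
under eq_bigr do under eq_bigr do rewrite transfer_mx_exp natr_card.
under eq_bigr do rewrite (sum_enum_val (fun t => \sum_(w : n.+1.-tuple T)
  (chain (enum_val _) t w)%:R)).
rewrite (sum_enum_val (fun s => \sum_t \sum_(w : n.+1.-tuple T)
  (chain s t w)%:R)).
under eq_bigr do rewrite exchange_big /=.
rewrite exchange_big; apply: eq_bigr => /= w _; case/tupleP: w => c w.
rewrite (bigD1 (src c)) //= [X in _ + X]big1 ?addr0 => [|s sc]; last first.
  rewrite big1 // => t _; rewrite -[_ && _]/(chain s t (c :: w)) chain_cons.
  by rewrite eq_sym (negbTE sc).
rewrite (bigD1 (dst (last c w))) //= [X in _ + X]big1 ?addr0 => [|t tc].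
  rewrite -[X in X%:R = _]/(nat_of_bool (chain _ _ (c :: w))) chain_cons.
  by rewrite !eqxx.
rewrite -[X in X%:R = _]/(nat_of_bool (chain _ _ (c :: w))) chain_cons.
by rewrite [dst _ == _]eq_sym (negbTE tc) andbF.
Qed.

Lemma mxtrace_transfer_mx n :
  \tr (transfer_mx ^+ n.+1)
    = #|[set w : n.+1.-tuple T | all P w
          && cycle (fun c c' => dst c == src c') w]|%:R.
Proof.
rewrite natr_card /mxtrace.
under eq_bigr do rewrite transfer_mx_exp natr_card.
rewrite (sum_enum_val (fun s => \sum_(w : n.+1.-tuple T) (chain s s w)%:R)).
rewrite exchange_big; apply: eq_bigr => /= w _; case/tupleP: w => c w.
rewrite (bigD1 (src c)) //= [X in _ + X]big1 ?addr0 => [|s sc].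
  rewrite -[X in X%:R = _]/(nat_of_bool (chain _ _ (c :: w))) chain_cons.
  by rewrite eqxx /= rcons_path; congr (_%:R); rewrite andbC -andbA.
rewrite -[X in X%:R = _]/(nat_of_bool (chain _ _ (c :: w))) chain_cons.
by rewrite eq_sym (negbTE sc).
Qed.

(** The involution reverses every edge, so it matches the edges from [s] to [t] with those from [t]
    to [s]. *)
Lemma transfer_mx_sym (f : T -> T) :
  involutive f -> (forall c, P (f c) = P c) ->
  (forall c, src (f c) = dst c) -> transfer_mx^T = transfer_mx.
Proof.
move=> fK Pf srcf; have dstf c : dst (f c) = src c by rewrite -srcf fK.
apply/matrixP => s t; rewrite !mxE; congr (_%:R).
rewrite -(on_card_preimset (onW_bij _ (inv_bij fK))); apply: eq_card => c.
by rewrite !inE Pf srcf dstf; congr (_ && _); rewrite andbC.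
Qed.

Lemma transfer_mx_ge0 s t : 0 <= transfer_mx s t.
Proof. by rewrite mxE. Qed.
End Chains.

(** * Slices of boxes *)

Lemma box_inj d (m : d.-tuple nat) (i j : box m) :
  (forall l, i l = j l :> nat) -> i = j.
Proof. by move=> ij; apply/ffunP => l; apply: val_inj; exact: ij. Qed.

Lemma card_box d (m : d.-tuple nat) : #|box m| = mpr m.
Proof.
rewrite card_dep_ffun foldrE big_map big_enum /=.
by apply: eq_bigr => k _; rewrite card_ord.
Qed.

Definition mkbox d (m : d.-tuple nat) (g : 'I_d -> nat)
  (gm : forall l, (g l < tnth m l)%N) : box m := [ffun l => Ordinal (gm l)].

Lemma mkboxE d (m : d.-tuple nat) g (gm : forall l, (g l < tnth m l)%N) l :
  mkbox gm l = g l :> nat.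
Proof. by rewrite ffunE. Qed.

(** The boolean selects dimer covers, so that both halves of the theorem are proved at once. *)
Definition covers (b : bool) d (K : {set 'I_d}) (m : d.-tuple nat) :=
  if b then Wtper K m else Wper K m.

Definition nbr d (K : {set 'I_d}) (m : d.-tuple nat) (l : 'I_d) : rel (box m) :=
  fun i i' => box_next l i i' || (l \in K) && box_wrap l i i'.

Lemma GammaE d (k : 'I_d) j q :
  Gamma k j q = ((j == k :> nat) == (q == k + d :> nat)%N).
Proof. by rewrite /Gamma; case: eqP; case: eqP. Qed.

Lemma coversP (b : bool) d (K : {set 'I_d}) m (phi : {ffun box m -> color d}) :
  reflect ((forall l i i', nbr K l i i' -> Gamma l (phi i) (phi i'))
           /\ (b -> forall i, (phi i < 2 * d)%N))
          (phi \in covers b K m).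
Proof.
have WperP : reflect (forall l i i', nbr K l i i' -> Gamma l (phi i) (phi i'))
    (phi \in Wper K m).
  rewrite !inE; apply: (iffP andP) => [[/forallP Wn /forall_inP Ww] l i i'|Wnw].
    case/orP => [li|/andP[lK li]].
      by have /forallP/(_ i)/forallP/(_ i')/implyP := Wn l; apply.
    by have /forallP/(_ i)/forallP/(_ i')/implyP := Ww l lK; apply.
  split; first apply/forallP => l; last apply/forall_inP => l lK.
    by do 2!apply/forallP => ?; apply/implyP => li; apply: Wnw; rewrite /nbr li.
  do 2!apply/forallP => ?; apply/implyP => li; apply: Wnw.
  by rewrite /nbr lK li orbT.
rewrite /covers; case: b.
  rewrite finset.in_set.
  apply: (iffP andP) => [[/WperP Wp /forallP nm]|[Wp nm]].
    by split=> // _.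
  by split; [exact/WperP | apply/forallP; exact: nm].
by apply: (iffP WperP) => [|[]].
Qed.

Section Slices.
Variable e : nat.
Implicit Types (k : 'I_e.+1) (m : e.-tuple nat) (x : nat).

Definition ins k x m : e.+1.-tuple nat :=
  [tuple (if unlift k l is Some l' then tnth m l' else x) | l < e.+1].

Lemma tnth_ins_at k x m : tnth (ins k x m) k = x.
Proof. by rewrite tnth_mktuple unlift_none. Qed.

Lemma tnth_ins_lift k x m l : tnth (ins k x m) (lift k l) = tnth m l.
Proof. by rewrite tnth_mktuple liftK. Qed.

Lemma mpr_ins k x m : mpr (ins k x m) = (x * mpr m)%N.
Proof.
rewrite /mpr (bigD1_ord k) //= tnth_ins_at; congr (_ * _)%N.
by apply: eq_bigr => l _; rewrite tnth_ins_lift.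
Qed.

(** * Points of a box as pairs of a position in a layer and a height *)

Section Put.
Variables (k : 'I_e.+1) (x : nat) (m : e.-tuple nat).

Fact put_subproof (y : box m) (j : 'I_x) l :
  ((if unlift k l is Some l' then y l' : nat else j) < tnth (ins k x m) l)%N.
Proof.
by case: unliftP => [l' ->|->]; rewrite ?tnth_ins_lift ?tnth_ins_at.
Qed.
Definition put (y : box m) (j : 'I_x) : box (ins k x m) :=
  mkbox (put_subproof y j).

Lemma put_at y j : put y j k = j :> nat.
Proof. by rewrite mkboxE unlift_none. Qed.
Lemma put_lift y j l : put y j (lift k l) = y l :> nat.
Proof. by rewrite mkboxE liftK. Qed.

Fact rest_subproof (i : box (ins k x m)) l : (i (lift k l) < tnth m l)%N.
Proof. by rewrite -(tnth_ins_lift k x). Qed.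
Definition rest (i : box (ins k x m)) : box m := mkbox (rest_subproof i).

Definition height (i : box (ins k x m)) : 'I_x :=
  cast_ord (tnth_ins_at k x m) (i k).

Lemma rest_put y j : rest (put y j) = y.
Proof. by apply: box_inj => l; rewrite mkboxE put_lift. Qed.
Lemma height_put y j : height (put y j) = j.
Proof. by apply: val_inj; rewrite /= put_at. Qed.
Lemma put_rest i : put (rest i) (height i) = i.
Proof.
apply: box_inj => l; case: (unliftP k l) => [l' ->|->].
  by rewrite put_lift mkboxE.
by rewrite put_at.
Qed.

Lemma forall_unlift (Q : pred 'I_e.+1) :
  [forall l, Q l] = Q k && [forall l, Q (lift k l)].
Proof.
apply/forallP/andP => [Ql|[Qk /forallP Ql] l].
  by split; [exact: Ql | apply/forallP => l; exact: Ql].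
by case: (unliftP k l) => [l' ->|->]; [exact: Ql | exact: Qk].
Qed.

Lemma forall_box_eq (y y' : box m) : [forall l, y' l == y l] = (y == y').
Proof.
apply/forallP/eqP => [yy|-> //]; apply: box_inj => l.
by rewrite (eqP (yy l)).
Qed.

(** With [nbr_put_at], this separates the constraints on a cover into those inside one layer and
    those linking a layer to the next. *)
Lemma nbr_put_lift (K : {set 'I_e.+1}) l y y' j j' :
  nbr K (lift k l) (put y j) (put y' j')
    = (j == j') && nbr (lift k @^-1: K) l y y'.
Proof.
have kl : (k == lift k l) = false by rewrite (negbTE (neq_lift k l)).
rewrite /nbr /box_next /box_wrap !forall_unlift !put_at kl addn0 inE.
rewrite !put_lift tnth_ins_lift andb_orr [j == j']eq_sym; congr (_ || _).
  congr (_ && _); apply: eq_forallb => l0.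
  by rewrite !put_lift (inj_eq lift_inj).
have -> : (put y' j' k == put y j k) = (j' == j) by rewrite -val_eqE /= !put_at.
have -> : [forall l0, (lift k l0 != lift k l) ==>
      (put y' j' (lift k l0) == put y j (lift k l0))]
    = [forall l0, (l0 != l) ==> (y' l0 == y l0)].
  apply: eq_forallb => l0; rewrite (inj_eq lift_inj); congr (_ ==> _).
  by rewrite -!val_eqE /= !put_lift.
by case: (j' == j); rewrite /= ?andbT ?andbF.
Qed.

Lemma nbr_put_at (K : {set 'I_e.+1}) y y' j j' :
  nbr K k (put y j) (put y' j')
    = (y == y') && ((j' == j.+1 :> nat)%N
                    || [&& k \in K, j.+1 == x & (j' == 0 :> nat)%N]).
Proof.
rewrite /nbr /box_next /box_wrap !forall_unlift !put_at !eqxx addn1 /=.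
rewrite [X in _.+1 == X]tnth_ins_at.
have -> : [forall l, put y' j' (lift k l) == put y j (lift k l)
    + (lift k l == k) :> nat]%N = (y == y').
  rewrite -forall_box_eq; apply: eq_forallb => l.
  rewrite !put_lift [lift k l == k]eq_sym (negbTE (neq_lift k l)) addn0.
  by rewrite -val_eqE.
have -> : [forall l, (lift k l != k) ==>
      (put y' j' (lift k l) == put y j (lift k l))] = (y == y').
  rewrite -forall_box_eq; apply: eq_forallb => l.
  by rewrite [lift k l == k]eq_sym neq_lift /= -!val_eqE /= !put_lift.
by case: (y == y'); rewrite /= ?andbT ?andbF.
Qed.
End Put.

(** * Layers as edges of the transfer multigraph, and its symmetry *)

Section Layers.
Variables (b : bool) (k : 'I_e.+1) (K : {set 'I_e}) (m : e.-tuple nat).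
Notation layer_config := {ffun box m -> color e.+1}.

Definition layer (c : layer_config) : bool :=
  [forall l : 'I_e, forall y, forall y',
     nbr K l y y' ==> Gamma (lift k l) (c y) (c y')]
  && (b ==> [forall y, (c y < 2 * e.+1)%N]).

(* Sites joined by a dimer to the preceding and to the following layer. *)
Definition src (c : layer_config) : {set box m} :=
  [set y | (c y == k + e.+1 :> nat)%N].
Definition dst (c : layer_config) : {set box m} :=
  [set y | (c y == k :> nat)%N].

Lemma layerP (c : layer_config) : reflect
  ((forall l y y', nbr K l y y' -> Gamma (lift k l) (c y) (c y'))
   /\ (b -> forall y, (c y < 2 * e.+1)%N)) (layer c).
Proof.
apply: (iffP andP) => [[/forallP lc bc]|[lc bc]]; split.
- move=> l y y'; have /forallP/(_ y)/forallP/(_ y')/implyP := lc l; exact.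
- by move=> bT; apply/forallP; exact: (implyP bc).
- by do 3!apply/forallP => ?; apply/implyP; exact: lc.
- by apply/implyP => /bc ?; apply/forallP.
Qed.

Lemma dst_srcP (c c' : layer_config) :
  reflect (forall y, Gamma k (c y) (c' y)) (dst c == src c').
Proof.
have GE (y : box m) : Gamma k (c y) (c' y) = ((y \in dst c) == (y \in src c')).
  by rewrite !inE GammaE.
apply: (iffP eqP) => [cc y|cc]; first by rewrite GE cc.
by apply/setP => y; apply/eqP; rewrite -GE.
Qed.

Definition swap_colors (c : layer_config) : layer_config :=
  [ffun y => tperm (inord k) (inord (k + e.+1)) (c y)].

Let k_color : (inord k : color e.+1) = k :> nat.
Proof. by rewrite inordK //; have := ltn_ord k; lia. Qed.
Let kd_color : (inord (k + e.+1) : color e.+1) = (k + e.+1)%N :> nat.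
Proof. by rewrite inordK //; have := ltn_ord k; lia. Qed.

Lemma swap_colorsK : involutive swap_colors.
Proof. by move=> c; apply/ffunP => y; rewrite !ffunE tpermK. Qed.

Lemma src_swap (c : layer_config) : src (swap_colors c) = dst c.
Proof.
apply/setP => y; rewrite !inE ffunE.
have := ltn_ord k.
by case: tpermP => [->|->|/eqP + /eqP];
  rewrite -?val_eqE /= ?k_color ?kd_color; lia.
Qed.

(** The constraints inside a layer only test the colors of directions other than [k], which the
    transposition fixes; nor does it create or remove monomers. *)
Lemma layer_swap (c : layer_config) : layer (swap_colors c) = layer c.
Proof.
have layer_sub c' : layer c' -> layer (swap_colors c').
  move=> /layerP[lc bc]; apply/layerP; split.
    move=> l y y' /lc; rewrite !GammaE !ffunE.
    have kl : (k != lift k l :> nat) by rewrite neq_lift.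
    move: (nat_of_ord (lift k l)) (ltn_ord (lift k l)) kl (ltn_ord k) => l1.
    by do 2!case: tpermP => [->|->|/eqP + /eqP];
      rewrite -?val_eqE /= ?k_color ?kd_color; lia.
  move=> /bc cb y; have := cb y; rewrite ffunE; have := ltn_ord k.
  by case: tpermP => [->|->|/eqP + /eqP];
    rewrite -?val_eqE /= ?k_color ?kd_color; lia.
by apply/idP/idP => /layer_sub //; rewrite swap_colorsK.
Qed.

Variable R : realType.
Definition tmx := transfer_mx R layer src dst.

Lemma tmx_sym : tmx^T = tmx.
Proof. exact: transfer_mx_sym swap_colorsK layer_swap src_swap. Qed.

Lemma tmx_ge0 i j : 0 <= tmx i j.
Proof. exact: transfer_mx_ge0. Qed.
End Layers.
End Slices.

(** * Covers counted by transfer matrices *)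

(** Treats open and closed walks together, with the condition on indices in the form that
    [nbr_put_at] produces. *)
Lemma tuple_walkP (T : Type) (r : rel T) (per : bool) n (w : n.+1.-tuple T) :
  reflect (forall j j' : 'I_n.+1,
      (j' == j.+1 :> nat)%N || [&& per, j.+1 == n.+1 & (j' == 0 :> nat)%N] ->
      r (tnth w j) (tnth w j'))
    (if per then cycle r w else sorted r w).
Proof.
pose x0 := tnth w ord0.
have sortedE : reflect (forall j j' : 'I_n.+1, (j' == j.+1 :> nat)%N ->
    r (tnth w j) (tnth w j')) (sorted r w).
  apply: (iffP (sortedP x0)) => [rw j j' /eqP jj|rw j].
    rewrite !(tnth_nth x0) jj; apply: rw.
    by rewrite size_tuple ltnS -ltnS -jj ltn_ord.
  rewrite size_tuple => jn; have j_lt := ltnW jn.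
  have := rw (Ordinal j_lt) (Ordinal jn); rewrite !(tnth_nth x0); apply.
  exact: eqxx.
case: per => /=; last first.
  by apply: (iffP sortedE) => rw j j' => [/orP[/rw|]|jj] //;
    apply: rw; rewrite jj.
have -> : cycle r w = sorted r w && r (tnth w ord_max) (tnth w ord0).
  case/tupleP: w @x0 sortedE => c w _ _ /=; rewrite rcons_path.
  congr (_ && r _ _).
  by rewrite (tnth_nth c) /= -[X in nth _ _ X](size_tuple w) nth_last.
apply: (iffP andP) => [[/sortedE rs r0] j j'|rw].
  case/orP => [/rs //|/andP[/eqP jn /eqP j0]].
  suff [-> ->] : j = ord_max /\ j' = ord0 by [].
  by split; apply: val_inj => //=; case: jn.
split; last by apply: rw; rewrite /= !eqxx.
by apply/sortedE => j j' jj; apply: rw; rewrite jj.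
Qed.

Section CardCovers.
Variables (R : realType) (e : nat) (b : bool).
Implicit Types (k : 'I_e.+1) (K : {set 'I_e.+1}) (m : e.-tuple nat).

(** Cutting a configuration into its layers across direction [k] is a bijection [F] with inverse
    [G]. Under it, the constraints in direction [k] say that successive layers agree on the dimers
    joining them, cyclically if [k] is periodic. *)
Lemma card_covers_walks K k n m :
  #|covers b K (ins k n.+1 m)|
    = #|[set w : n.+1.-tuple {ffun box m -> color e.+1} |
          all (@layer _ b k (lift k @^-1: K) m) w
          && (let r := fun c c' => dst k c == src k c' in
              if k \in K then cycle r w else sorted r w)]|.
Proof.
pose F (phi : {ffun box (ins k n.+1 m) -> color e.+1}) :=
  [tuple [ffun y => phi (put k y j)] | j < n.+1].
pose G (w : n.+1.-tuple {ffun box m -> color e.+1}) :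
    {ffun box (ins k n.+1 m) -> color e.+1} :=
  [ffun i => tnth w (height i) (rest i)].
have bijF : bijective F.
  exists G => [phi|w].
    by apply/ffunP => i; rewrite ffunE tnth_mktuple ffunE put_rest.
  apply: eq_from_tnth => j; rewrite tnth_mktuple; apply/ffunP => y.
  by rewrite !ffunE height_put rest_put.
rewrite -(on_card_preimset (onW_bij _ bijF)); apply: eq_card => phi.
rewrite [RHS]inE [RHS]inE; have FE y j : phi (put k y j) = tnth (F phi) j y.
  by rewrite tnth_mktuple ffunE.
apply/coversP/andP => [[nbrP bP]|[/all_tnthP lay /tuple_walkP wlk]]; split.
- apply/all_tnthP => j; apply/layerP; split=> [l y y' yy|bT y].
    rewrite -!FE; apply: nbrP.
    by rewrite nbr_put_lift eqxx.
  by rewrite -FE; exact: bP.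
- apply/tuple_walkP => j j' jj; apply/dst_srcP => y; rewrite -!FE.
  by apply: nbrP; rewrite nbr_put_at eqxx.
- move=> l i i'; rewrite -(put_rest i) -(put_rest i') !FE.
  case: (unliftP k l) => [l' ->|->].
    rewrite nbr_put_lift => /andP[/eqP -> il].
    by have /layerP[+ _] := lay (height i'); apply.
  by rewrite nbr_put_at => /andP[/eqP -> /wlk /dst_srcP].
- move=> bT i; rewrite -(put_rest i) FE.
  by have /layerP[_ ->] := lay (height i).
Qed.

Notation tmxK k K m := (tmx b k (lift k @^-1: K) m R).

Lemma card_covers_entry_sum K k n m : (0 < n)%N -> k \notin K ->
  #|covers b K (ins k n m)|%:R = entry_sum (tmxK k K m ^+ n).
Proof.
case: n => // n _ /negbTE kK.
by rewrite entry_sum_transfer_mx card_covers_walks kK.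
Qed.

Lemma card_covers_mxtrace K k n m : (0 < n)%N -> k \in K ->
  #|covers b K (ins k n m)|%:R = \tr (tmxK k K m ^+ n).
Proof.
case: n => // n _ kK.
by rewrite mxtrace_transfer_mx card_covers_walks kK.
Qed.

Lemma card_states m : #|{: {set box m}}| = (2 ^ mpr m)%N.
Proof.
by rewrite -[LHS]cardsT -powersetT card_powerset cardsT card_box.
Qed.

Lemma natr_states m : #|{: {set box m}}|%:R = 2 ^+ mpr m :> R.
Proof. by rewrite card_states natrX. Qed.

(** Making direction [k] periodic leaves the layers unchanged, so the open and the periodic counts
    come from one transfer matrix. *)
Lemma preimset_lift_setU1 k K : lift k @^-1: (k |: K) = lift k @^-1: K.
Proof.
by apply/setP => l; rewrite !inE eq_sym (negbTE (neq_lift k l)).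
Qed.

Lemma card_covers_periodize K k r n m : k \notin K -> (0 < r)%N -> (0 < n)%N ->
  #|covers b K (ins k (2 * r * n) m)|%:R
    <= 2 ^+ mpr m * #|covers b (k |: K) (ins k (2 * r) m)|%:R ^+ n :> R.
Proof.
move=> kK r0 n0; rewrite (card_covers_entry_sum _ _ kK) ?muln_gt0 ?r0 ?n0 //.
rewrite (card_covers_mxtrace _ _ (setU11 k K)) ?muln_gt0 ?r0 //.
rewrite preimset_lift_setU1.
apply: le_trans (entry_sum_exp_le_trace (tmx_sym _ _ _ _ _) r n) _.
by rewrite natr_states.
Qed.

Lemma card_covers_periodic_ratio K k p q n m :
  k \notin K -> (0 < p)%N -> (0 < q)%N -> (0 < n)%N ->
  #|covers b (k |: K) (ins k (p + 2 * q) m)|%:R ^+ (2 * n)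
    <= #|covers b K (ins k (2 * n * p) m)|%:R
       * #|covers b (k |: K) (ins k (2 * q) m)|%:R ^+ (2 * n) :> R.
Proof.
move=> kK p0 q0 n0; rewrite (card_covers_entry_sum _ _ kK) ?muln_gt0 ?p0 ?n0 //.
rewrite !(card_covers_mxtrace _ _ (setU11 k K)) ?muln_gt0 ?addn_gt0 ?p0 ?q0 //.
rewrite preimset_lift_setU1.
have N0 : (0 < #|{: {set box m}}|)%N by rewrite card_states expn_gt0.
exact: (mxtrace_exp_le_entry_sum (tmx_sym b k (lift k @^-1: K) m R)
  (@tmx_ge0 _ b k (lift k @^-1: K) m R) p q n N0).
Qed.

(** The preceding bound at [q = 0]: the trace of [A ^+ 0] is the number of states [2 ^ mpr m], which
    explains the value [ln 2] of the periodic entropies at 0. *)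
Lemma card_covers_periodic_le K k p n m :
  k \notin K -> (0 < p)%N -> (0 < n)%N ->
  #|covers b (k |: K) (ins k p m)|%:R ^+ (2 * n)
    <= #|covers b K (ins k (2 * n * p) m)|%:R * (2 ^+ mpr m) ^+ (2 * n) :> R.
Proof.
move=> kK p0 n0; rewrite (card_covers_entry_sum _ _ kK) ?muln_gt0 ?p0 ?n0 //.
rewrite (card_covers_mxtrace _ _ (setU11 k K)) // preimset_lift_setU1.
have N0 : (0 < #|{: {set box m}}|)%N by rewrite card_states expn_gt0.
have := mxtrace_exp_le_entry_sum (tmx_sym b k (lift k @^-1: K) m R)
  (@tmx_ge0 _ b k (lift k @^-1: K) m R) p 0 n N0.
by rewrite muln0 addn0 expr0 mxtrace1 natr_states.
Qed.

Lemma card_covers_subadditive K k x y m :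
  k \notin K -> (0 < x)%N -> (0 < y)%N ->
  (#|covers b K (ins k (x + y) m)|
    <= #|covers b K (ins k x m)| * #|covers b K (ins k y m)|)%N.
Proof.
move=> kK x0 y0; rewrite -(ler_nat R) natrM.
rewrite !(card_covers_entry_sum _ _ kK) ?addn_gt0 ?x0 //.
by apply: entry_sum_expD; exact: tmx_ge0.
Qed.

Lemma card_covers_le d (K : {set 'I_d}) (m : d.-tuple nat) :
  (#|covers b K m| <= (2 * d).+1 ^ mpr m)%N.
Proof.
by apply: leq_trans (max_card _) _; rewrite card_ffun card_ord card_box.
Qed.
End CardCovers.

(** * Covers of the torus and matchings *)

Lemma entry_sum_exp_le (R : realType) n (A A' : 'M[R]_n) k :
  (forall i j, 0 <= A i j <= A' i j) ->
  entry_sum (A ^+ k) <= entry_sum (A' ^+ k).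
Proof.
move=> AA'; have A0 i j : 0 <= A i j by case/andP: (AA' i j).
have AleA' i j : A i j <= A' i j by case/andP: (AA' i j).
apply: ler_sum => i _; apply: ler_sum => j _.
elim: k i j => [|k IHk] i j; first by rewrite !expr0.
rewrite !exprS -!mulmxE !mxE; apply: ler_sum => l _.
by apply: ler_pM => //; exact: expmx_ge0.
Qed.

Section Torus.
Variables (e : nat) (m : e.-tuple nat).
Hypotheses (m_gt0 : forall k, (0 < tnth m k)%N)
  (m_even : forall k, ~~ odd (tnth m k)).

Lemma torus_next_inj k : injective (@torus_next e m k).
Proof.
move=> i j /ffunP ij; apply/ffunP => l; have := ij l; rewrite !ffunE.
by case: eqP => // _; exact: ordS_inj.
Qed.

Lemma nbr_torus_next k (i : box m) : nbr [set: 'I_e] k i (torus_next k i).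
Proof.
rewrite /nbr inE /=; have ik := ltn_ord (i k).
case: (ltngtP (i k).+1 (tnth m k)) => [ik_lt|ik_gt|ik_eq]; last first.
- apply/orP; right.
  rewrite /box_wrap ik_eq eqxx !ffunE eqxx /= ik_eq modnn eqxx.
  by apply/forallP => l; apply/implyP => /negbTE lk; rewrite ffunE lk.
- by rewrite ltnNge ik in ik_gt.
apply/orP; left; apply/forallP => l; rewrite ffunE.
case: (l =P k) => [->|_] /=; first by rewrite modn_small // addn1.
by rewrite addn0.
Qed.

Let k := @ord_max e.
Let K := [set: 'I_e].
Variable b : bool.
Notation conf := {ffun box m -> color e.+1}.

Lemma lift_maxE (l : 'I_e) : lift k l = l :> nat.
Proof. by rewrite /= /bump leqNgt ltn_ord. Qed.

Lemma layer_torus_step (c : conf) l (i : box m) : layer b k K c ->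
  (c (torus_next l i) == (l + e.+1)%N :> nat) = (c i == l :> nat).
Proof.
case/layerP => /(_ l _ _ (nbr_torus_next l i)) + _.
by rewrite GammaE lift_maxE => /eqP ->.
Qed.

Lemma torus_prev l (i : box m) : exists i', i = torus_next l i'.
Proof.
have [g _ gK] := injF_bij (@torus_next_inj l).
by exists (g i); rewrite gK.
Qed.

(** The dimers lying within the layer, each recorded at its first half; those in direction [k] are
    recorded by [src] and [dst]. *)
Definition dimers (c : conf) : {set box m * 'I_e} :=
  [set a : box m * 'I_e | c a.1 == a.2 :> nat].

Lemma mem_ends_dimers (c : conf) (a : box m * 'I_e) z :
  layer b k K c -> a \in dimers c -> z \in ends a ->
  (c z = a.2 :> nat /\ a.1 = z)
  \/ (c z = (a.2 + e.+1)%N :> nat /\ torus_next a.2 a.1 = z).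
Proof.
move=> lc; rewrite !inE => ca /orP[/eqP ->|/eqP ->].
  by left; rewrite (eqP ca).
by right; split=> //; apply/eqP; rewrite layer_torus_step.
Qed.

(** The color of a site determines the direction of the dimer covering it and which end the site is,
    so by injectivity of [torus_next] two dimers sharing a site coincide. Positive even sides are at
    least 2, as [edges] demands. *)
Lemma dimers_matching (c : conf) : layer b k K c ->
  dimers c \in matchings (~: (src k c :|: dst k c)).
Proof.
move=> lc; rewrite inE; apply/and3P; split.
- apply/fintype.subsetP => -[i l] _; rewrite inE /=.
  by have := m_gt0 l; have := m_even l; case: (tnth m l) => [|[]].
- apply/forall_inP => a ca; apply/forall_inP => a' ca'; apply/implyP.
  apply: contraR; rewrite -setI_eq0 => /set0Pn[z]; rewrite inE => /andP[za za'].
  have := mem_ends_dimers lc ca za; have := mem_ends_dimers lc ca' za'.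
  case: a ca za => i l _ _; case: a' ca' za' => i' l' _ _ /=.
  have := ltn_ord l; have := ltn_ord l'.
  move=> ll ll' [[-> ->]|[-> <-]] [[/esym e1]|[/esym e1]];
    try by exfalso; lia.
    by move=> ->; rewrite (val_inj e1).
  have {e1} -> : l = l' by apply: val_inj; exact: addIn e1.
  by move/torus_next_inj => ->.
- apply/forall_inP => -[i l] il; apply/fintype.subsetP => z zil; rewrite !inE.
  have := mem_ends_dimers lc il zil; have := ltn_ord l.
  have : k = e :> nat by [].
  by move=> -> ll [[-> _]|[-> _]] /=; lia.
Qed.

Lemma dimers_perfect (c : conf) : b -> layer b k K c ->
  dimers c \in perfect_matchings (~: (src k c :|: dst k c)).
Proof.
move=> bT lc; rewrite inE dimers_matching //=; apply/fintype.subsetP => z.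
rewrite !inE negb_or /= => /andP[zs zd].
have /layerP[_ /(_ bT z) zlt] := lc.
have [ze|ze] := ltnP (c z) e.
  apply/bigcupP; exists (z, Ordinal ze); first by rewrite inE.
  by rewrite !inE eqxx.
(* Excluding first halves within the layer, [e] (in [dst]), [2 * e + 1] (in [src]) and the monomer
   leaves the second halves [l + e.+1] with [l < e]; the dimer then starts at the preceding site. *)
have {zs zd zlt ze} [ze zl] : (e < c z)%N /\ (c z - e.+1 < e)%N.
  by move: zlt zs zd ze; move: (nat_of_ord (c z)) => q; lia.
have [i /esym zi] := torus_prev (Ordinal zl) z.
apply/bigcupP; exists (i, Ordinal zl); last by rewrite !inE /= zi eqxx orbT.
by rewrite inE -(layer_torus_step _ _ lc) /= zi subnK.
Qed.

(** Every color other than the monomer is detected at a site by a dimer starting there, a dimer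
    ending there, [dst] or [src]; the remaining sites are the monomers. *)
Lemma dimers_inj (c c' : conf) : layer b k K c -> layer b k K c' ->
  src k c = src k c' -> dst k c = dst k c' -> dimers c = dimers c' -> c = c'.
Proof.
move=> lc lc' /setP ss /setP dd /setP DD.
apply/ffunP => z; apply: val_inj => /=.
have E (q : nat) : (q < 2 * e.+1)%N -> (c z == q :> nat) = (c' z == q :> nat).
  move=> qlt; have [qe|qe] := ltnP q e.
    by have := DD (z, Ordinal qe); rewrite !inE.
  have [->|q_ne] := eqVneq q e; first by have := dd z; rewrite !inE.
  have [->|q_ned] := eqVneq q (e + e.+1)%N; first by have := ss z; rewrite !inE.
  have ql : (q - e.+1 < e)%N by lia.
  have [l lE] : exists l : 'I_e, q = (l + e.+1)%N.
    by exists (Ordinal ql); rewrite /= subnK //; lia.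
  have [i ->] := torus_prev l z.
  by have := DD (i, l); rewrite !inE lE !layer_torus_step.
move: (ltn_ord (c z)) (ltn_ord (c' z)) E.
move: (nat_of_ord (c z)) (nat_of_ord (c' z)) => q q' qlt q'lt E.
have [q2|q2] := ltnP q (2 * e.+1).
  by have := E _ q2; rewrite eqxx => /esym/eqP.
have [q2'|q2'] := ltnP q' (2 * e.+1); last by lia.
by have := E _ q2'; rewrite eqxx => /eqP.
Qed.

Variable R : realType.
Definition torus_mx : 'M[R]_#|{: {set box m}}| := if b then Bt R m else B R m.

Lemma torus_mx_sym : torus_mx^T = torus_mx.
Proof.
rewrite /torus_mx; case: b; apply/matrixP => i j;
by rewrite !mxE /= finset.setIC finset.setUC.
Qed.

Lemma torus_mx_ge0 i j : 0 <= torus_mx i j.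
Proof. by rewrite /torus_mx; case: b; rewrite mxE /=; case: ifP. Qed.

(** [dimers] injects the layers with given end states into the matchings counted on the right. A
    single such layer makes the two states disjoint, since no site has two colors, so the entry on
    the right is not the default 0. *)
Lemma tmx_le_torus_mx i j : tmx b k K m R i j <= torus_mx i j.
Proof.
set C := [set c : conf | [&& layer b k K c, src k c == enum_val i
                              & dst k c == enum_val j]].
have CP c : c \in C ->
    [/\ layer b k K c, src k c = enum_val i & dst k c = enum_val j].
  by rewrite inE => /and3P[-> /eqP -> /eqP ->].
have -> : tmx b k K m R i j = #|C|%:R by rewrite mxE.
have [C0|[c0 /CP[_ s0 d0]]] := set_0Vmem C.
  by rewrite C0 cards0 torus_mx_ge0.
have sd0 : enum_val i :&: enum_val j = finset.set0.
  rewrite -s0 -d0; apply/setP => z; rewrite !inE /=.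
  by apply/negbTE/negP => /andP[/eqP -> /eqP]; lia.
have injC : {in C &, injective dimers}.
  move=> c c' /CP[lc sc dc] /CP[lc' sc' dc'].
  by apply: dimers_inj; rewrite ?sc ?sc' ?dc ?dc'.
rewrite -(card_in_imset injC) /torus_mx.
case bE: b; rewrite mxE /= sd0 eqxx ler_nat; apply: subset_leq_card;
apply/fintype.subsetP => _ /imsetP[c /CP[lc <- <-] ->].
  by apply: dimers_perfect => //; rewrite bE.
exact: dimers_matching.
Qed.

Lemma card_covers_le_spectral_radius n : (0 < n)%N ->
  #|covers b (~: [set k]) (ins k n m)|%:R
    <= 2 ^+ mpr m * spectral_radius torus_mx ^+ n.
Proof.
move=> n0; rewrite (card_covers_entry_sum R) ?inE ?eqxx //.
have -> : lift k @^-1: (~: [set k]) = K.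
  by apply/setP => l; rewrite !inE eq_sym neq_lift.
apply: le_trans (entry_sum_exp_le (A' := torus_mx) n _) _.
  by move=> i j; rewrite tmx_le_torus_mx tmx_ge0.
apply: le_trans (entry_sum_exp_le_spectral_radius torus_mx_sym n) _.
by rewrite natr_states.
Qed.
End Torus.

(** * Multidimensional Fekete lemma *)

Lemma tnth_nseq n (x : nat) (k : 'I_n) : tnth (nseq_tuple n x) k = x.
Proof. by rewrite (tnth_nth 0%N) nth_nseq ltn_ord. Qed.

Definition upd d (m : d.-tuple nat) (k : 'I_d) (x : nat) : d.-tuple nat :=
  [tuple (if l == k then x else tnth m l) | l < d].

Lemma mpr_upd d (m : d.-tuple nat) k x :
  mpr (upd m k x) = (x * \prod_(l < d | l != k) tnth m l)%N.
Proof.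
rewrite /mpr (bigD1 k) //= tnth_mktuple eqxx; congr (_ * _)%N.
by apply: eq_bigr => l /negbTE lk; rewrite tnth_mktuple lk.
Qed.

Section Fekete.
Variables (R : realType) (d : nat) (f : d.-tuple nat -> R) (C : R).
Hypotheses (f_ge0 : forall m, 0 <= f m) (f_le : forall m, f m <= C * (mpr m)%:R)
  (f_sub : forall m k x y, (0 < x)%N -> (0 < y)%N ->
     f (upd m k (x + y)) <= f (upd m k x) + f (upd m k y)).

Lemma mpr_gt0 (m : d.-tuple nat) :
  (forall k, (0 < tnth m k)%N) -> (0 < mpr m)%N.
Proof. by move=> m0; rewrite prodn_gt0. Qed.

Lemma bound_ge0 : 0 <= C.
Proof.
have m1 k : tnth (nseq_tuple d 1%N) k = 1%N by rewrite tnth_nseq.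
have := le_trans (f_ge0 _) (f_le (nseq_tuple d 1%N)).
by rewrite /mpr big1 // mulr1.
Qed.

(** The side is cut into [a] pieces of length [n] and a remainder of length [b], whose contribution
    is bounded by [C] times its volume. *)
Lemma subadditive_division m k n a b : (0 < n)%N ->
  f (upd m k (a * n + b)) <= a%:R * f (upd m k n)
    + C * ((mpr (upd m k (a * n + b)))%:R - a%:R * (mpr (upd m k n))%:R).
Proof.
move=> n0; rewrite [X in C * X](_ : _ = (mpr (upd m k b))%:R); last first.
  by rewrite !mpr_upd mulnDl natrD !natrM; ring.
elim: a => [|a IHa].
  by rewrite mul0n add0n mul0r add0r f_le.
(* Subadditivity is assumed for positive lengths only. If [a] and [b] vanish, the claim only adds a
   nonnegative term. *)
have [ab0|ab0] := posnP (a * n + b).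
  move: ab0 => /eqP; rewrite addn_eq0 muln_eq0 (gtn_eqF n0) orbF.
  move=> /andP[/eqP -> /eqP ->]; rewrite mul1n addn0 mul1r lerDl.
  by rewrite mulr_ge0 ?bound_ge0.
rewrite mulSn -addnA; apply: le_trans (f_sub _ _ n0 ab0) _.
by rewrite -natr1 mulrDl mul1r; lra.
Qed.

(* The coordinates of [m] are replaced one by one by those of [m0]; [P] counts
   the copies of the current box that have been packed into [m]. *)
Lemma subadditive_packing (m0 m : d.-tuple nat) (D : R) :
  (forall k, (0 < tnth m0 k)%N) -> 0 <= D ->
  (forall k, (tnth m0 k)%:R <= D * (tnth m k)%:R) ->
  f m <= (mpr m)%:R * (f m0 / (mpr m0)%:R + C * (d%:R * D)).
Proof.
move=> m0_gt0 D0 m0_le.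
have C0 := bound_ge0.
have V0 : 0 < (mpr m0)%:R :> R by rewrite ltr0n mpr_gt0.
pose mix j : d.-tuple nat :=
  [tuple (if (l < j)%N then tnth m0 l else tnth m l) | l < d].
(* Each replaced coordinate wastes at most a fraction [D] of the volume packed so far, so a fraction
   [1 - j * D] of [m] stays covered; the uncovered volume is charged at rate [C]. *)
have main j : (j <= d)%N -> exists P : R, [/\ 0 <= P,
    f m <= P * f (mix j) + C * ((mpr m)%:R - P * (mpr (mix j))%:R),
    P * (mpr (mix j))%:R <= (mpr m)%:R
  & (mpr m)%:R * (1 - j%:R * D) <= P * (mpr (mix j))%:R].
  elim: j => [_|j IHj jd].
    have -> : mix 0%N = m by apply: eq_from_tnth => l; rewrite tnth_mktuple.
    by exists 1; split; lra.
  have [P [P0 fP Ple Pge]] := IHj (ltnW jd).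
  pose k := Ordinal jd.
  have mixS : mix j.+1 = upd (mix j.+1) k (tnth m0 k).
    apply: eq_from_tnth => l; rewrite !tnth_mktuple.
    by case: (l =P k) => [->|] //=; rewrite ltnS leqnn.
  have mixj : mix j = upd (mix j.+1) k (tnth m k).
    apply: eq_from_tnth => l; rewrite !tnth_mktuple.
    case: (l =P k) => [->|lk] /=; first by rewrite ltnn.
    rewrite [in RHS]ltnS [in RHS]leq_eqVlt; case: (nat_of_ord l =P j) => // lj.
    by case: lk; apply: val_inj.
  have := subadditive_division (mix j.+1) k (tnth m k %/ tnth m0 k)
    (tnth m k %% tnth m0 k) (m0_gt0 k).
  rewrite -divn_eq -mixj -mixS.
  set a : R := (tnth m k %/ tnth m0 k)%:R => fa.
  pose V := (\prod_(l < d | l != k) tnth (mix j.+1) l)%N.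
  have VjE : mpr (mix j) = (tnth m k * V)%N by rewrite mixj mpr_upd.
  have VSE : mpr (mix j.+1) = (tnth m0 k * V)%N by rewrite {1}mixS mpr_upd.
  have aV : a * (mpr (mix j.+1))%:R <= (mpr (mix j))%:R.
    by rewrite VjE VSE /a -natrM ler_nat mulnA leq_mul2r leq_divM orbT.
  have aV' : (mpr (mix j))%:R * (1 - D) <= a * (mpr (mix j.+1))%:R.
    rewrite VjE VSE !natrM mulrAC mulrA ler_wpM2r ?ler0n //.
    have := m0_le k.
    have : (tnth m k)%:R <= a * (tnth m0 k)%:R + (tnth m0 k)%:R :> R.
      rewrite /a -natrM -natrD ler_nat {1}(divn_eq (tnth m k) (tnth m0 k)).
      by rewrite leq_add2l ltnW // ltn_pmod.
    by lra.
  exists (P * a); split.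
  - by rewrite mulr_ge0.
  - have := ler_wpM2l P0 fa; rewrite mulrDr.
    have -> : P * (C * ((mpr (mix j))%:R - a * (mpr (mix j.+1))%:R))
        = C * (P * (mpr (mix j))%:R - P * a * (mpr (mix j.+1))%:R) by ring.
    by rewrite mulrA => Pfa; nra.
  - by rewrite -mulrA; apply: le_trans (ler_wpM2l P0 aV) Ple.
  rewrite -mulrA; apply: le_trans (ler_wpM2l P0 aV'); rewrite mulrA.
  (* If [D <= 1], the lower bound on the packed volume is multiplied by [1 - D]; otherwise this
     factor is negative and the upper bound is used. *)
  have [D1|D1] := leP D 1.
    apply: le_trans (ler_wpM2r _ Pge); last by rewrite subr_ge0.
    rewrite -mulrA ler_wpM2l // -natr1.
    by have := mulr_ge0 (ler0n R j) (sqr_ge0 D); nra.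
  apply: le_trans (ler_wnM2r _ Ple); last by rewrite subr_le0 ltW.
  rewrite ler_wpM2l // lerD2l lerN2 -[leLHS]mul1r ler_wpM2r // ler1n //.
have [P [P0 fP Ple Pge]] := main d (leqnn d).
have mixd : mix d = m0.
  by apply: eq_from_tnth => l; rewrite tnth_mktuple ltn_ord.
rewrite mixd in fP Ple Pge.
apply: le_trans fP _; rewrite [leRHS]mulrDr; apply: lerD.
  rewrite mulrCA [leRHS]mulrC ler_wpM2r // ler_pdivlMr //.
by have := ler_wpM2l C0 Pge; nra.
Qed.

(** The limit is the infimum of the densities: a box [m0] nearly attaining it is packed into every
    large box. *)
Lemma subadditive_cvg : cvg (f m / (mpr m)%:R @[m --> minfty d])%classic.
Proof.
pose E := [set f m / (mpr m)%:R
  | m in [set m : d.-tuple nat | forall k, (0 < tnth m k)%N]]%classic.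
have E_lb : has_lbound E.
  by exists 0 => _ [m _ <-]; rewrite divr_ge0.
have E_inf : has_inf E.
  split=> //; exists (f (nseq_tuple d 1%N) / (mpr (nseq_tuple d 1%N))%:R).
  by exists (nseq_tuple d 1%N) => // k; rewrite tnth_nseq.
apply/cvg_ex; exists (inf E); apply/cvgrPdist_le => eps eps0.
have eps2 : 0 < eps / 2 by rewrite divr_gt0.
have [_ [m0 m0_gt0 <-] fm0] := inf_adherent eps2 E_inf.
have C0 := bound_ge0.
(* Chosen so that the waste [C * (d%:R * D)] is at most [eps / 2]; the added 1 keeps the denominator
   positive. *)
pose D := eps / 2 / (C * d%:R + 1).
have CD0 : 0 < C * d%:R + 1 by rewrite ltr_wpDl // mulr_ge0.
have D0 : 0 < D by rewrite !divr_gt0.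
pose M := (\max_(k < d) tnth m0 k)%N.
have [N NM] : exists N : nat, M%:R <= D * N%:R.
  exists (Num.trunc (M%:R / D)).+1; rewrite mulrC -ler_pdivrMr //.
  exact/ltW/truncnS_gt.
exists N.+1 => m mN.
have m_gt0 k : (0 < tnth m k)%N by apply: leq_trans (mN k).
have V0 : 0 < (mpr m)%:R :> R by rewrite ltr0n mpr_gt0.
have fm : inf E <= f m / (mpr m)%:R by apply: ge_inf => //; exists m.
rewrite distrC ger0_norm ?subr_ge0 // lerBlDl ler_pdivrMr // mulrC.
apply: le_trans (subadditive_packing m0_gt0 (ltW D0) _) _ => [k|].
  apply: le_trans (_ : M%:R <= _); first by rewrite ler_nat leq_bigmax.
  apply: le_trans NM _; rewrite ler_pM2l // ler_nat.
  exact: leq_trans (mN k).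
rewrite ler_pM2l //.
suff : C * (d%:R * D) <= eps / 2 by lra.
rewrite mulrA /D mulrA ler_pdivrMr // mulrC ler_pM2l //; lra.
Qed.
End Fekete.

(** * Entropies *)

Section LnNat.
Variable R : realType.

Lemma ln_nat_ge0 n : 0 <= ln (n%:R : R).
Proof. by case: n => [|n]; [rewrite ln0 | rewrite ln_ge0 // ler1n]. Qed.

Lemma ln_nat_leM a b c : (a <= b * c)%N ->
  ln (a%:R : R) <= ln (b%:R) + ln (c%:R).
Proof.
case: a => [|a] abc; first by rewrite ln0 // addr_ge0 ?ln_nat_ge0.
have /andP[b0 c0] : (0 < b)%N && (0 < c)%N.
  by rewrite -muln_gt0 (leq_trans _ abc).
rewrite -lnM ?posrE ?ltr0n // -natrM ler_ln ?posrE ?ltr0n ?muln_gt0 ?b0 //.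
by rewrite ler_nat.
Qed.
End LnNat.

Definition del e (k : 'I_e.+1) (m : e.+1.-tuple nat) : e.-tuple nat :=
  [tuple tnth m (lift k l) | l < e].

Lemma ins_del e k (m : e.+1.-tuple nat) : ins k (tnth m k) (del k m) = m.
Proof.
apply: eq_from_tnth => l; case: (unliftP k l) => [l' ->|->].
  by rewrite tnth_ins_lift tnth_mktuple.
by rewrite tnth_ins_at.
Qed.

Lemma upd_ins e k (m : e.+1.-tuple nat) x : upd m k x = ins k x (del k m).
Proof.
apply: eq_from_tnth => l; rewrite tnth_mktuple.
case: (unliftP k l) => [l' ->|->].
  by rewrite tnth_ins_lift tnth_mktuple eq_sym (negbTE (neq_lift _ _)).
by rewrite tnth_ins_at eqxx.
Qed.

Lemma cons_tuple_ins e x (m : e.-tuple nat) : cons_tuple x m = ins ord0 x m.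
Proof.
apply: eq_from_tnth => l; case: (unliftP ord0 l) => [l' ->|->].
  by rewrite tnth_ins_lift tnthS.
by rewrite tnth_ins_at tnth0.
Qed.

Section Entropy.
Variables (R : realType) (e : nat) (b : bool).
Notation d := e.+1.

Let F (m : d.-tuple nat) : R := ln #|covers b finset.set0 m|%:R / (mpr m)%:R.
Let G (x : nat) (m : e.-tuple nat) : R :=
  ln #|covers b [set ord0] (cons_tuple x m)|%:R / (mpr m)%:R.

Definition entropy : R := (lim (F m @[m --> minfty d]))%classic.
Definition per_entropy (x : nat) : R :=
  if x == 0%N then ln 2 else (lim (G x m @[m --> minfty e]))%classic.

Lemma ln_card_covers_le d' (K : {set 'I_d'}) (m : d'.-tuple nat) :
  ln (#|covers b K m|%:R : R) <= ln ((2 * d').+1)%:R * (mpr m)%:R.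
Proof.
rewrite mulr_natr -lnXn ?ltr0n // -natrX.
have := card_covers_le b K m; case: #|_| => [|c] cle.
  by rewrite ln0 ?ln_nat_ge0.
by rewrite ler_ln ?posrE ?ltr0n ?ler_nat // (leq_trans _ cle).
Qed.

Lemma cvg_entropy : cvg (F m @[m --> minfty d])%classic.
Proof.
apply: (@subadditive_cvg _ _ _ (ln (2 * d).+1%:R)) => [m|m|m k x y x0 y0].
- exact: ln_nat_ge0.
- exact: ln_card_covers_le.
rewrite !upd_ins; apply: ln_nat_leM.
by apply: (card_covers_subadditive R); rewrite ?inE.
Qed.

(** Fekete's lemma with the periodic side [x] fixed and absorbed into the constant: direction [k] of
    [m] is direction [lift ord0 k] of the whole box, which is not periodic. *)
Lemma cvg_per_entropy x : cvg (G x m @[m --> minfty e])%classic.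
Proof.
apply: (@subadditive_cvg _ _ _ (ln (2 * d).+1%:R * x%:R))
  => [m|m|m k y z y0 z0].
- exact: ln_nat_ge0.
- rewrite -mulrA -natrM -(mpr_ins ord0) -cons_tuple_ins.
  exact: ln_card_covers_le.
have updE w : cons_tuple x (upd m k w)
    = ins (lift ord0 k) w (del (lift ord0 k) (ins ord0 x m)).
  rewrite -upd_ins cons_tuple_ins; apply: eq_from_tnth => l.
  rewrite [RHS]tnth_mktuple; case: (unliftP ord0 l) => [l' ->|->].
    by rewrite !tnth_ins_lift tnth_mktuple (inj_eq lift_inj).
  by rewrite !tnth_ins_at (negbTE (neq_lift _ _)).
rewrite !updE; apply: ln_nat_leM.
by apply: (card_covers_subadditive R); rewrite // inE eq_sym neq_lift.
Qed.

Lemma minfty_cvg_dist n (f : n.-tuple nat -> R) eps :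
  cvg (f m @[m --> minfty n])%classic -> 0 < eps ->
  exists N, forall m : n.-tuple nat, (forall k, (N <= tnth m k)%N) ->
    `|lim (f m @[m --> minfty n])%classic - f m| <= eps.
Proof.
by move=> cf eps0; have /cvgrPdist_le/(_ eps eps0) := cf.
Qed.

Lemma ln2_le1 : ln 2 <= 1 :> R.
Proof. by have := @le_ln1Dx R 1; rewrite -natr1; apply; lra. Qed.

(** In [card_covers_periodize] the factor [2 ^ mpr m] costs [ln 2 / (2 * r * n)] per site, at most
    [n%:R^-1] uniformly in [m]; this uniformity lets all sides grow together. *)
Lemma density_periodize (K : {set 'I_d}) k r n m :
  k \notin K -> (0 < r)%N -> (0 < n)%N -> (0 < mpr m)%N ->
  ln #|covers b K (ins k (2 * r * n) m)|%:R / (mpr (ins k (2 * r * n) m))%:R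
    <= n%:R^-1
       + ln #|covers b (k |: K) (ins k (2 * r) m)|%:R
         / (mpr (ins k (2 * r) m))%:R :> R.
Proof.
move=> kK r0 n0 m0; rewrite !mpr_ins.
have := @card_covers_periodize R e b K k r n m kK r0 n0.
set s := #|_|; set t := #|_|; set V := mpr m => st.
have r0R : 1 <= r%:R :> R by rewrite ler1n.
have n0R : 0 < n%:R :> R by rewrite ltr0n.
have V0R : 0 < V%:R :> R by rewrite ltr0n.
rewrite ler_pdivrMr ?ltr0n ?muln_gt0 ?r0 ?n0 //.
have -> : (n%:R^-1 + ln t%:R / (2 * r * V)%:R) * (2 * r * n * V)%:R
    = 2 * r%:R * V%:R + n%:R * ln t%:R :> R.
  rewrite !natrM; field; rewrite ?pnatr_eq0 -?lt0n ?r0 ?n0 ?m0 //.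
have [s0|s_gt0] := posnP s.
  by rewrite s0 ln0 // addr_ge0 ?mulr_ge0 ?ln_nat_ge0 ?ler0n.
have t_gt0 : (0 < t)%N.
  rewrite lt0n; apply: contraTneq st => ->; rewrite expr0n (gtn_eqF n0) mulr0.
  by rewrite -ltNge ltr0n.
have : ln (s%:R : R) <= V%:R * ln 2 + n%:R * ln t%:R.
  apply: le_trans (_ : _ <= ln (2 ^+ V * t%:R ^+ n)) _.
    by rewrite ler_ln ?posrE ?ltr0n ?mulr_gt0 ?exprn_gt0 ?ltr0n.
  by rewrite lnM ?posrE ?exprn_gt0 ?ltr0n // !lnXn ?ltr0n // !mulr_natl.
have : V%:R * ln 2 <= V%:R * (2 * r%:R) :> R.
  by rewrite ler_pM2l //; have := ln2_le1; lra.
lra.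
Qed.

(** If [x] and [k] are positive then so are [s] and [y], and logarithms apply; otherwise, as
    [ln 0 = 0], the left side is nonpositive. *)
Lemma ln_ratio (x y s k : nat) : x%:R ^+ k <= s%:R * y%:R ^+ k :> R ->
  k%:R * (ln x%:R - ln y%:R) <= ln s%:R :> R.
Proof.
have [->|k0] := posnP k; first by rewrite mul0r ln_nat_ge0.
move=> xsy; have [->|x0] := posnP x.
  rewrite ln0 // sub0r mulrN; apply: le_trans (ln_nat_ge0 _ _).
  by rewrite oppr_le0 mulr_ge0 ?ln_nat_ge0 ?ler0n.
have xk0 : 0 < x%:R ^+ k :> R by rewrite exprn_gt0 ?ltr0n.
have [s0 y0] : (0 < s)%N /\ (0 < y)%N.
  split; rewrite lt0n; apply: contraTneq xsy => ->.
    by rewrite mul0r -ltNge.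
  by rewrite expr0n (gtn_eqF k0) mulr0 -ltNge.
have := xsy; rewrite -ler_ln ?posrE ?mulr_gt0 ?exprn_gt0 ?ltr0n //.
rewrite lnM ?posrE ?exprn_gt0 ?ltr0n // !lnXn ?ltr0n //.
by rewrite -[ln x%:R *+ k]mulr_natl -[ln y%:R *+ k]mulr_natl; lra.
Qed.

Lemma natr_inv_small (eps : R) : 0 < eps ->
  exists N : nat, forall n, (N < n)%N -> n%:R^-1 <= eps.
Proof.
move=> eps0; exists (Num.trunc eps^-1) => n Nn.
rewrite -[eps]invrK lef_pV2 ?posrE ?invr_gt0 ?ltr0n ?(leq_ltn_trans _ Nn) //.
by apply: le_trans (ltW (truncnS_gt _)) _; rewrite ler_nat.
Qed.

Lemma entropy_le_per r : (0 < r)%N ->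
  entropy <= per_entropy (2 * r)%N / (2 * r)%:R.
Proof.
move=> r0; apply/ler_addgt0Pr => eps eps0.
have r20 : (0 < 2 * r)%N by rewrite muln_gt0.
have eps3 : 0 < eps / 3 by rewrite divr_gt0.
have [N1 FN] := minfty_cvg_dist cvg_entropy eps3.
have [N2 GN] := minfty_cvg_dist (cvg_per_entropy (x := (2 * r)%N)) eps3.
have [N3 n_eps] := natr_inv_small eps3.
rewrite /per_entropy gtn_eqF //.
set g := lim _ in GN *; rewrite -/entropy in FN.
(* One [n] serves as side of [m] and as number of repetitions, large enough for both limits and for
   the error [n%:R^-1]. *)
pose n := (N1 + N2 + N3).+1.
pose m := nseq_tuple e n.
have mG : `|g - G (2 * r)%N m| <= eps / 3.
  by apply: GN => k; rewrite tnth_nseq /n; lia.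
have mF : `|entropy - F (ins ord0 (2 * r * n) m)| <= eps / 3.
  apply: FN => k; case: (unliftP ord0 k) => [k' ->|->].
    by rewrite tnth_ins_lift tnth_nseq /n; lia.
  rewrite tnth_ins_at; apply: (@leq_trans n); first by rewrite /n; lia.
  exact: leq_pmull.
have V0 : (0 < mpr m)%N by rewrite mpr_gt0 // => k; rewrite tnth_nseq.
have key : F (ins ord0 (2 * r * n) m) <= n%:R^-1 + G (2 * r)%N m / (2 * r)%:R.
  apply: le_trans (density_periodize _ r0 _ V0) _; rewrite ?inE //.
  by rewrite finset.setU0 /G cons_tuple_ins mpr_ins natrM invfM mulrA mulrAC.
have rR : 1 <= (2 * r)%:R :> R by rewrite ler1n.
have : (g + eps / 3) / (2 * r)%:R <= g / (2 * r)%:R + eps / 3.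
  rewrite mulrDl lerD2l ler_pdivrMr ?(lt_le_trans ltr01) // ler_peMr //.
  exact: ltW.
have : G (2 * r)%N m / (2 * r)%:R <= (g + eps / 3) / (2 * r)%:R.
  rewrite ler_wpM2r ?invr_ge0 ?ler0n //.
  by move: mG; rewrite ler_norml => /andP[]; lra.
have : n%:R^-1 <= eps / 3 by apply: n_eps; rewrite /n; lia.
move: mF; rewrite ler_norml => /andP[_].
by lra.
Qed.

Lemma per_ratio_le_entropy p q : (0 < p)%N ->
  (per_entropy (p + 2 * q)%N - per_entropy (2 * q)%N) / p%:R <= entropy.
Proof.
move=> p0; apply/ler_addgt0Pr => eps eps0.
(* [y m] is the trace of [A ^+ (2 * q)]: for [q = 0] it counts states, with density exactly
   [ln 2]. *)
pose y (m : e.-tuple nat) : nat :=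
  if q == 0%N then (2 ^ mpr m)%N
  else #|covers b [set ord0] (cons_tuple (2 * q)%N m)|.
have eps3 : 0 < eps / 3 by rewrite divr_gt0.
have [N1 FN] := minfty_cvg_dist cvg_entropy eps3.
have [N2 GN] := minfty_cvg_dist (cvg_per_entropy (x := (p + 2 * q)%N)) eps3.
have [N3 YN] : exists N, forall m : e.-tuple nat,
    (forall k, (N <= tnth m k)%N) ->
    `|per_entropy (2 * q)%N - ln (y m)%:R / (mpr m)%:R| <= eps / 3.
  rewrite /per_entropy /y muln_eq0 /=; case: eqP => [_|_]; last first.
    exact: minfty_cvg_dist (cvg_per_entropy (x := (2 * q)%N)) eps3.
  exists 1%N => m m1; rewrite natrX lnXn ?ltr0n //.
  rewrite -[ln 2 *+ _]mulr_natr mulfK ?subrr ?normr0 ?ltW //.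
  by rewrite pnatr_eq0 -lt0n mpr_gt0.
pose n := (N1 + N2 + N3).+1.
pose m := nseq_tuple e n.
have mG : `|per_entropy (p + 2 * q)%N - G (p + 2 * q)%N m| <= eps / 3.
  rewrite /per_entropy gtn_eqF ?addn_gt0 ?p0 //.
  by apply: GN => k; rewrite tnth_nseq /n; lia.
have mY : `|per_entropy (2 * q)%N - ln (y m)%:R / (mpr m)%:R| <= eps / 3.
  by apply: YN => k; rewrite tnth_nseq /n; lia.
have mF : `|entropy - F (ins ord0 (2 * n * p) m)| <= eps / 3.
  apply: FN => k; case: (unliftP ord0 k) => [k' ->|->].
    by rewrite tnth_ins_lift tnth_nseq /n; lia.
  rewrite tnth_ins_at; apply: (@leq_trans n); first by rewrite /n; lia.
  by rewrite -mulnA mulnCA leq_pmulr // muln_gt0.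
have V0 : (0 < mpr m)%N by rewrite mpr_gt0 // => k; rewrite tnth_nseq.
have V0R : 0 < (mpr m)%:R :> R by rewrite ltr0n.
have p1R : 1 <= p%:R :> R by rewrite ler1n.
have p0R : 0 < p%:R :> R by rewrite ltr0n.
have key : (G (p + 2 * q)%N m - ln (y m)%:R / (mpr m)%:R) / p%:R
    <= F (ins ord0 (2 * n * p) m).
  have ns : ord0 \notin (finset.set0 : {set 'I_d}) by rewrite inE.
  have := @ln_ratio #|covers b [set ord0] (cons_tuple (p + 2 * q)%N m)| (y m)
    #|covers b finset.set0 (ins ord0 (2 * n * p) m)| (2 * n).
  rewrite /G /F mpr_ins !natrM.
  set a := ln _; set c := ln (y m)%:R; set s := ln _ => ratio.
  rewrite ler_pdivlMr ?mulr_gt0 ?ltr0n //.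
  have -> : (a / (mpr m)%:R - c / (mpr m)%:R) / p%:R
      * (2 * n%:R * p%:R * (mpr m)%:R) = 2 * n%:R * (a - c).
    by field; rewrite !gt_eqF.
  apply: ratio; rewrite /y !cons_tuple_ins.
  have [->|q0] := posnP q.
    have := @card_covers_periodic_le R e b _ _ p n m ns p0 isT.
    by rewrite muln0 addn0 natrX finset.setU0.
  have := @card_covers_periodic_ratio R e b _ _ p q n m ns p0 q0 isT.
  by rewrite finset.setU0.
have : (per_entropy (p + 2 * q)%N - per_entropy (2 * q)%N - 2 * eps / 3) / p%:R
    <= (G (p + 2 * q)%N m - ln (y m)%:R / (mpr m)%:R) / p%:R.
  rewrite ler_wpM2r ?invr_ge0 ?ler0n //.
  by move: mG mY; rewrite !ler_norml => /andP[? ?] /andP[? ?]; lra.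
have : 2 * eps / 3 / p%:R <= 2 * eps / 3.
  by rewrite ler_pdivrMr // ler_peMr //; lra.
move: mF; rewrite ler_norml => /andP[+ _].
rewrite [(_ - 2 * eps / 3) / _]mulrBl.
by lra.
Qed.
End Entropy.

Lemma spectral_radius_ge0 (R : realType) n (A : 'M[R]_n) :
  0 <= spectral_radius A.
Proof.
rewrite /spectral_radius; set E := (X in sup X).
have E_ge0 x : E x -> 0 <= x by move=> [[a c] _ <-]; rewrite sqrtr_ge0.
(* On an empty or unbounded set [sup] takes the default value 0. *)
have [supE|/sup_out -> //] := pselect (has_sup E).
by have [[x Ex] Eub] := supE; exact: le_trans (E_ge0 x Ex) (ub_le_sup Eub Ex).
Qed.

(* Colors 0 and [d] are the two halves of a dimer in direction 0. *)
Lemma covers_gt0 (b : bool) e (m : e.+1.-tuple nat) :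
  (0 < #|covers b finset.set0 m|)%N.
Proof.
apply/card_gt0P.
exists [ffun i : box m => if odd (i ord0) then inord e.+1 else ord0].
have e1 : (inord e.+1 : color e.+1) = e.+1 :> nat by rewrite inordK //; lia.
apply/coversP; split=> [l i i'|_ i]; last first.
  by rewrite ffunE; case: ifP => _; rewrite ?e1 //; lia.
rewrite /nbr inE orbF => /forallP/(_ ord0)/eqP i0; rewrite GammaE !ffunE i0.
have := ltn_ord l; case: (unliftP ord0 l) => [l' ->|->] ll.
  rewrite addn0; have : (0 < lift ord0 l')%N by [].
  move: (nat_of_ord (lift ord0 l')) ll => w ll w0.
  by case: ifP => _; rewrite ?e1 /=; lia.
by rewrite eqxx addn1 /= add0n; case: (odd (i ord0)); rewrite /= ?e1 ?eqxx.
Qed.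

(** * Bounding the entropy by the spectral radius for an even torus *)

Section TorusBound.
Variables (R : realType) (e : nat) (b : bool) (m : e.-tuple nat).
Hypotheses (m_gt0 : forall k, (0 < tnth m k)%N)
  (m_even : forall k, ~~ odd (tnth m k)).

Notation density K M := (ln #|covers b K M|%:R / (mpr M)%:R : R).

Let K (j : nat) := [set l : 'I_e.+1 | (l < j)%N].
(* The box after the first [j] directions have been made periodic. *)
Let M (j n : nat) : e.+1.-tuple nat := ins ord_max n
  [tuple (if (l < j)%N then tnth m l else tnth m l * n)%N | l < e].

(** Each periodization divides one side by [n] at a cost of [n%:R^-1]. Positivity of the count is
    carried along to make the spectral radius positive at the end. *)
Lemma density_torus n j : (0 < n)%N -> (j <= e)%N ->
  (0 < #|covers b (K j) (M j n)|)%N /\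
  density finset.set0 (M 0%N n) <= j%:R / n%:R + density (K j) (M j n).
Proof.
move=> n0; elim: j => [_|j IHj je].
  have -> : K 0 = finset.set0 by apply/setP => l; rewrite !inE.
  by rewrite covers_gt0 mul0r add0r.
have [cov_gt0 dens] := IHj (ltnW je).
pose l0 : 'I_e := Ordinal je; pose k := lift ord_max l0.
have kE : k = j :> nat by rewrite /= /bump leqNgt je.
have KS : K j.+1 = k |: K j.
  apply/setP => l; rewrite !inE ltnS leq_eqVlt; congr (_ || _).
  by rewrite -kE.
have kK : k \notin K j by rewrite inE kE ltnn.
have Mk i : tnth (M i n) k = (if (j < i)%N then tnth m l0 else tnth m l0 * n)%N.
  by rewrite tnth_ins_lift tnth_mktuple.
have delM : del k (M j.+1 n) = del k (M j n).
  apply: eq_from_tnth => l; rewrite !tnth_mktuple.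
  case: unliftP => // l' kl; rewrite !tnth_mktuple ltnS leq_eqVlt.
  case: eqP => // l'j; have /eqP := neq_lift k l; case.
  by rewrite kl; congr (lift _ _); apply: val_inj.
have r0 : (0 < (tnth m l0)./2)%N.
  by have := m_gt0 l0; have := m_even l0; case: (tnth m l0) => [|[]].
have m2 : tnth m l0 = (2 * (tnth m l0)./2)%N.
  by rewrite mul2n even_halfK.
have Mj : M j n = ins k (2 * (tnth m l0)./2 * n) (del k (M j n)).
  by rewrite -{1}(ins_del k (M j n)) Mk ltnn -m2.
have MS : M j.+1 n = ins k (2 * (tnth m l0)./2) (del k (M j n)).
  by rewrite -{1}(ins_del k (M j.+1 n)) Mk ltnSn -m2 delM.
have V0 : (0 < mpr (del k (M j n)))%N.
  apply: mpr_gt0 => l; rewrite !tnth_mktuple; case: unliftP => // l' _.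
  by rewrite tnth_mktuple; case: ifP; rewrite ?muln_gt0 m_gt0.
have := @card_covers_periodize R e b _ _ _ n (del k (M j n)) kK r0 n0.
have := @density_periodize R e b _ _ _ n _ kK r0 n0 V0.
rewrite -Mj -MS -KS => densS cardS; split.
  rewrite lt0n; apply: contraTneq cardS => ->.
  by rewrite expr0n (gtn_eqF n0) mulr0 -ltNge ltr0n.
apply: le_trans dens _; rewrite -natr1 mulrDl div1r -addrA lerD2l.
exact: densS.
Qed.

Lemma entropy_le_torus :
  entropy R e b <= ln (spectral_radius (torus_mx m b R)) / (mpr m)%:R.
Proof.
apply/ler_addgt0Pr => eps eps0.
set beta := spectral_radius _.
have eps2 : 0 < eps / 2 by rewrite divr_gt0.
(* The [e] periodizations and the final spectral bound each cost at most [n%:R^-1]. *)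
have eps3 : 0 < eps / 2 / e.+1%:R by rewrite divr_gt0.
have [N1 FN] := minfty_cvg_dist (@cvg_entropy R e b) eps2.
have [N2 n_eps] := natr_inv_small eps3.
pose n := (N1 + N2).+1.
have n0 : (0 < n)%N by [].
have n0R : 0 < n%:R :> R by rewrite ltr0n.
have V0 : (0 < mpr m)%N by rewrite mpr_gt0.
have V0R : 0 < (mpr m)%:R :> R by rewrite ltr0n.
have mF : `|entropy R e b - density finset.set0 (M 0 n)| <= eps / 2.
  apply: FN => k; case: (unliftP ord_max k) => [k' ->|->].
    rewrite tnth_ins_lift tnth_mktuple.
    apply: (@leq_trans n); first by rewrite /n; lia.
    exact: leq_pmull.
  by rewrite tnth_ins_at /n; lia.
have [] := density_torus n0 (leqnn e).
have -> : K e = ~: [set ord_max].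
  apply/setP => l; rewrite !inE; apply/idP/idP.
    by apply: contraTneq => ->; rewrite ltnn.
  by rewrite -val_eqE /=; have := ltn_ord l; lia.
have -> : M e n = ins ord_max n m.
  by congr ins; apply: eq_from_tnth => l; rewrite tnth_mktuple ltn_ord.
have := @card_covers_le_spectral_radius e m m_gt0 m_even b R n n0.
rewrite -/beta mpr_ins; set c := #|_| => cbeta c_gt0 dens.
have c_gt0R : 0 < c%:R :> R by rewrite ltr0n.
have beta_gt0 : 0 < beta.
  rewrite lt0r spectral_radius_ge0 andbT; apply: contraTneq cbeta => ->.
  by rewrite expr0n (gtn_eqF n0) mulr0 -ltNge.
have ln_c : ln (c%:R : R) <= (mpr m)%:R * ln 2 + n%:R * ln beta.
  apply: le_trans (_ : _ <= ln (2 ^+ mpr m * beta ^+ n)) _.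
    by rewrite ler_ln ?posrE ?mulr_gt0 ?exprn_gt0.
  by rewrite lnM ?posrE ?exprn_gt0 // !lnXn // !mulr_natl.
have : ln (c%:R : R) / (n * mpr m)%:R <= n%:R^-1 + ln beta / (mpr m)%:R.
  rewrite ler_pdivrMr ?ltr0n ?muln_gt0 ?n0 // natrM.
  have -> : (n%:R^-1 + ln beta / (mpr m)%:R) * (n%:R * (mpr m)%:R)
     = (mpr m)%:R + n%:R * ln beta by field; rewrite !gt_eqF.
  apply: le_trans ln_c _; rewrite lerD2r ler_piMr ?ler0n //.
  exact: ln2_le1.
have : e%:R / n%:R + n%:R^-1 <= eps / 2 :> R.
  rewrite -[X in _ + X]mul1r -mulrDl natr1 mulrC -ler_pdivlMr ?ltr0n //.
  by apply: n_eps; rewrite ltnS leq_addl.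
move: mF; rewrite ler_norml => /andP[_].
by lra.
Qed.
End TorusBound.

(** * Identification of the entropies and conclusion *)

Lemma Wper_set0 d (m : d.-tuple nat) : Wper finset.set0 m = W m.
Proof.
apply/setP => phi; rewrite !inE -[RHS]andbT; congr (_ && _).
by apply/forall_inP => k; rewrite inE.
Qed.

Lemma h_entropy (R : realType) e : h R e.+1 = entropy R e false.
Proof.
rewrite /h /entropy; do 2!f_equal; apply: funext => m.
by rewrite /covers Wper_set0.
Qed.

Lemma ht_entropy (R : realType) e : ht R e.+1 = entropy R e true.
Proof.
rewrite /ht /entropy; do 2!f_equal; apply: funext => m.
by rewrite /covers /Wtper Wper_set0.
Qed.

Theorem theorem6p5 (R : realType) (d p r q : nat)
    (hd : (2 <= d)%N) (hp : (0 < p)%N) (hr : (0 < r)%N) :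
  [/\ h R d <= hbar R d.-1 (2 * r) / (2 * r)%:R,
      (hbar R d.-1 (p + 2 * q) - hbar R d.-1 (2 * q)) / p%:R <= h R d,
      ht R d <= hcheck R d.-1 (2 * r) / (2 * r)%:R
    & (hcheck R d.-1 (p + 2 * q) - hcheck R d.-1 (2 * q)) / p%:R <= ht R d]
  /\
  (forall m' : d.-1.-tuple nat,
     (forall k, (0 < tnth m' k)%N) ->
     (forall k, ~~ odd (tnth m' k)) ->
     h R d <= ln (spectral_radius (B R m')) / (mpr m')%:R /\
     ht R d <= ln (spectral_radius (Bt R m')) / (mpr m')%:R).
Proof.
case: d hd => // e _ /=; rewrite h_entropy ht_entropy; split.
  split.
  - exact: (@entropy_le_per R e false).
  - exact: (@per_ratio_le_entropy R e false).
  - exact: (@entropy_le_per R e true).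
  - exact: (@per_ratio_le_entropy R e true).
move=> m m_gt0 m_even; split.
  exact: (@entropy_le_torus R e false m).
exact: (@entropy_le_torus R e true m).
Qed.
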